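(* Let $X$ be a paracompact (Tychonoff) space. The following are equivalent: (a) $X$ is a finite $C$-space; (b) for any space $Y$ and any aspherical sequence of strongly lower semi-continuous maps $\phi_n\colon X\to 2^Y$ ($n\in\mathbb N$), there exists $m$ such that $\phi_m$ admits a continuous selection; (c) for any space $Y$ and any aspherical sequence $\phi_n\colon X\to 2^Y$ ($n\in\mathbb N$) of set-valued maps with open graph (i.e. $\{(x,y)\in X\times Y: y\in\phi_n(x)\}$ is open in $X\times Y$), there exists $m$ such that $\phi_m$ admits a continuous selection.
   Context: All spaces are Tychonoff. A set is functionally open if it is a cozero set. A space $X$ is a finite $C$-space if for every sequence $\{\omega_n\}_{n\in\mathbb N}$ of finite covers of $X$ by functionally open sets there exist $k$ and finite families $\gamma_1,\dots,\gamma_k$, each consisting of pairwise disjoint functionally open sets, such that each $\gamma_n$ refines $\omega_n$ and $\bigcup_{n=1}^k\gamma_n$ covers $X$. $2^Y$ denotes the family of nonempty subsets of $Y$. A map $\theta\colon X\to 2^Y$ is strongly lower semi-continuous if for every compact $K\subset Y$ the set $\{x\in X: K\subset\theta(x)\}$ is open in $X$. For $A\subset B$, $A$ is $C^m$-embedded in $B$ if every continuous image in $A$ of a $k$-sphere, $k\le m$, is contractible in $B$. A sequence $\theta_n\colon X\to 2^Y$ is aspherical if $\theta_n(x)\subset\theta_{n+1}(x)$ and $\theta_n(x)$ is $C^{n-1}$-embedded in $\theta_{n+1}(x)$ for all $x\in X$, $n\in\mathbb N$. A continuous selection for $\theta$ is a continuous $f\colon X\to Y$ with $f(x)\in\theta(x)$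 for all $x$. *)

(* Defs.v *)
From HB Require Import structures.
From mathcomp Require Import all_boot all_order all_algebra.
From mathcomp Require Import all_classical all_reals all_analysis.
From mathcomp Require Import Rstruct Rstruct_topology.
Set Implicit Arguments. Unset Strict Implicit. Unset Printing Implicit Defensive.
Import Order.TTheory GRing.Theory Num.Theory.
Local Open Scope classical_set_scope.
Local Open Scope ring_scope.

Notation RR := Rdefinitions.R.

Definition tychonoff_space (X : topologicalType) : Prop :=
  accessible_space X /\
  forall (x : X) (B : set X), closed B -> ~ B x ->
    exists f : X -> RR, continuous f /\ f x = 0 /\ (forall b, B b -> f b = 1).

Definition functionally_open (X : topologicalType) (U : set X) : Prop :=
  exists f : X -> RR, continuous f /\ U = [set x | f x != 0].

Definition locally_finite_family (X : topologicalType) (F : set (set X)) : Prop :=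
  forall x : X, exists N : set X, open N /\ N x /\
    finite_set [set U | F U /\ U `&` N !=set0].

Definition paracompact (X : topologicalType) : Prop :=
  hausdorff_space X /\
  forall W : set (set X), (forall U, W U -> open U) -> \bigcup_(U in W) U = setT ->
    exists V : set (set X),
      (forall U, V U -> open U) /\ \bigcup_(U in V) U = setT /\
      (forall U, V U -> exists U', W U' /\ U `<=` U') /\
      locally_finite_family V.

(* Finite C-space. Families are indexed by nat from 0:
   omega n corresponds to omega_{n+1} of the paper. *)
Definition finite_C_space (X : topologicalType) : Prop :=
  forall omega : nat -> set (set X),
    (forall n, finite_set (omega n) /\
               (forall U, omega n U -> functionally_open U) /\
               \bigcup_(U in omega n) U = setT) ->
    exists (k : nat) (gamma : nat -> set (set X)),
      (forall n, (n < k)%N ->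
         finite_set (gamma n) /\
         (forall U, gamma n U -> functionally_open U) /\
         (forall U V, gamma n U -> gamma n V -> U <> V -> U `&` V = set0) /\
         (forall U, gamma n U -> exists V, omega n V /\ U `<=` V)) /\
      \bigcup_(n in [set n | (n < k)%N]) \bigcup_(U in gamma n) U = setT.

Definition strongly_lsc (X Y : topologicalType) (theta : X -> set Y) : Prop :=
  forall K : set Y, compact K -> open [set x | K `<=` theta x].

Definition open_graph (X Y : topologicalType) (theta : X -> set Y) : Prop :=
  open [set p : X * Y | theta p.1 p.2].

Definition sphere (k : nat) : set 'rV[RR]_(k.+1) :=
  [set v | \sum_(i < k.+1) (v ord0 i) ^+ 2 = 1].
Arguments sphere k : clear implicits.

Definition contractible_in (Y T : topologicalType) (B : set Y) (S : set T)
  (f : T -> Y) : Prop :=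
  exists H : T * RR -> Y,
    {within S `*` `[0, 1]%classic, continuous H} /\
    (forall t s, S t -> `[0, 1]%classic s -> B (H (t, s))) /\
    (forall t, S t -> H (t, 0) = f t) /\
    exists y0 : Y, forall t, S t -> H (t, 1) = y0.

Definition Cm_embedded (Y : topologicalType) (m : nat) (A B : set Y) : Prop :=
  forall k : nat, (k <= m)%N ->
    forall f : 'rV[RR]_(k.+1) -> Y,
      {within sphere k, continuous f} -> f @` sphere k `<=` A ->
      contractible_in B (sphere k) f.

(* Aspherical sequence, indexed from 0: theta n corresponds to theta_{n+1}
   of the paper, so theta_{n+1} is C^{n}-embedded in theta_{n+2}. *)
Definition aspherical (X Y : topologicalType) (theta : nat -> X -> set Y) : Prop :=
  forall (x : X) (n : nat),
    theta n x `<=` theta n.+1 x /\ Cm_embedded n (theta n x) (theta n.+1 x).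

(* Values in 2^Y: nonempty subsets. *)
Definition nonempty_valued (X Y : topologicalType) (theta : X -> set Y) : Prop :=
  forall x, theta x !=set0.

Definition has_continuous_selection (X Y : topologicalType) (theta : X -> set Y)
  : Prop := exists f : X -> Y, continuous f /\ forall x, theta x (f x).

(* Main.v *)
Require Import Defs.
From HB Require Import structures.
From mathcomp Require Import all_boot all_order all_algebra.
From mathcomp Require Import all_classical all_reals all_analysis.
From mathcomp Require Import Rstruct Rstruct_topology.
From mathcomp Require Import finmap zify lra.

(* (a) => (b). First, a paracompact finite C-space has the C-property with finitely
   many disjoint families also for sequences of infinite open covers. Any open
   cover W has a countable refinement O_0, O_1, ..., each O_r being a disjoint
   union of open sets inside members of W, together with a continuous h >= 0 such
   that h < r + 1 is covered by O_0, ..., O_r. If the slices i <= h <= i + 1 had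
   unbounded dimension, essential families on far apart slices would combine
   into two-element covers violating the finite C-property. So {h >= j} is
   finite-dimensional for some j, hence is covered by boundedly many disjoint
   families, while W is essentially finite on the rest.
   Next, covers omega_n and maps of the joins omega_0 * ... * omega_(n-1) to Y are
   built inductively: around x the join is locally finite, so the map extends
   to its cone inside a later phi_m(x) by asphericity, and by strong lower
   semi-continuity the whole cone stays in phi_m(x') for x' near x; this defines
   omega_n. A disjoint refinement by finitely many families then maps X into a
   finite join, which gives the selection.
   (b) => (c). By the tube lemma an open graph implies strong lower
   semi-continuity.
   (c) => (a). For covers omega_n let Y be the product of real lines indexed by the
   pairs (i, U), and let phi_m(x) be the set of points that, read level by level,
   reach by level m a positive coordinate (i, U) with x in U before anything
   inconsistent with x occurs. A selection of phi_m is read off as disjoint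
   families gamma_0, ..., gamma_m. *)

Import Order.TTheory GRing.Theory Num.Theory.
Import numFieldNormedType.Exports.
Local Open Scope fset_scope.
Local Open Scope classical_set_scope.
Local Open Scope ring_scope.
Set Implicit Arguments. Unset Strict Implicit. Unset Printing Implicit Defensive.

(* Makes the lemmas on normed modules apply to the constant Rdefinitions.R. *)
HB.instance Definition _ := NormedModule.copy RR RR^o.

(** * Paracompact spaces *)

Lemma open_from_near (T : topologicalType) (A : set T) :
  (forall x, A x -> \forall y \near x, A y) -> open A.
Proof. by rewrite openE. Qed.

Lemma near_open (T : topologicalType) (A : set T) x :
  open A -> A x -> \forall y \near x, A y.
Proof. by move=> oA Ax; apply: open_nbhs_nbhs. Qed.

Lemma notin_closureP (T : topologicalType) (A : set T) x :
  ~ closure A x <-> \forall y \near x, ~ A y.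
Proof.
split=> [nAx|nAx clA].
  have oC : open (~` closure A) by rewrite openC; exact: closed_closure.
  by apply: filterS (near_open oC nAx) => y ncl Ay; apply/ncl/subset_closure.
by have [y []] := clA _ nAx.
Qed.

Lemma near_finite_forall (T : topologicalType) (x : T)
    (I : choiceType) (D : set I) (Q : I -> T -> Prop) :
  finite_set D -> (forall i, D i -> \forall y \near x, Q i y) ->
  \forall y \near x, forall i, D i -> Q i y.
Proof.
by move=> /finite_fsetP[E ->] nQ; apply: filter_bigI.
Qed.

Definition locally_finite_indexed (X : topologicalType) (I : choiceType)
    (A : I -> set X) :=
  forall x : X, exists2 N, nbhs x N & finite_set [set i | A i `&` N !=set0].

(** Only finitely many [A i] come near [x], and off [A i] the condition [Q i] holds anyway, so the
    conditions reduce to finitely many. *)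
Lemma locally_finite_near (X : topologicalType) (I : choiceType)
    (A Q : I -> set X) (x : X) :
  locally_finite_indexed A -> (forall i y, ~ A i y -> Q i y) ->
  (forall i, \forall y \near x, Q i y) -> \forall y \near x, forall i, Q i y.
Proof.
move=> lfA AQ nQ; have [N Nx finD] := lfA x.
have nQD := near_finite_forall finD (fun i _ => nQ i).
move: Nx nQD; apply: filterS2 => y Ny Qy i.
have [Aiy|/AQ//] := pselect (A i y).
by apply: Qy; exists y.
Qed.

Lemma locally_finite_subset (X : topologicalType) (I : choiceType)
    (A B : I -> set X) :
  (forall i, B i `<=` A i) -> locally_finite_indexed A ->
  locally_finite_indexed B.
Proof.
move=> BA lfA x; have [N Nx finD] := lfA x; exists N => //.
apply: sub_finite_set finD => i [y [/BA Ay Ny]]; by exists y.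
Qed.

Section Paracompact.
Variables (X : topologicalType) (pX : paracompact X).

(* If each point of B is separated from A by its own neighbourhood, a locally
   finite refinement glues these neighbourhoods. *)
Lemma paracompact_separate (A B : set X) : closed B ->
  (forall b, B b -> exists U, [/\ open U, U b & closure U `&` A = set0]) ->
  exists G, [/\ open G, B `<=` G & closure G `&` A = set0].
Proof.
move=> clB sepB.
pose W := [set U | open U /\ (closure U `&` A = set0 \/ U `&` B = set0)].
have covW : \bigcup_(U in W) U = setT.
  rewrite eqEsubset; split => // x _.
  have [Bx|nBx] := pselect (B x).
    by have [U [oU Ux UA]] := sepB x Bx; exists U => //; split=> //; left.
  exists (~` B) => //; split; first by rewrite openC.
  by right; rewrite setICl.
have [|V [oV [Vcov [Vref Vlf]]]] := pX.2 W _ covW; first by move=> U [].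
exists (\bigcup_(U in [set U | V U /\ U `&` B !=set0]) U); split.
- by apply: bigcup_open => U [/oV].
- move=> b Bb; have [U VU Ub] : (\bigcup_(U in V) U) b by rewrite Vcov.
  by exists U => //; split=> //; exists b.
- rewrite -subset0 => x [clx Ax].
  apply: (_ : ~ closure _ x) clx; apply/notin_closureP.
  have [N [oN [Nx finN]]] := Vlf x.
  (* A member of [V] that meets [B] lies in some [U'] of the first kind in [W], whose closure misses
     [A] and hence [x]. *)
  have nearU U : V U /\ U `&` N !=set0 ->
      \forall y \near x, U `&` B !=set0 -> ~ U y.
    move=> [VU _]; have [U' [[oU' UB] UU']] := Vref _ VU.
    have [->|/set0P] := eqVneq (U `&` B) set0.
      by apply: nearW => y /set0P; rewrite eqxx.
    move=> [b [Ub Bb]]; case: UB => [clU'A|U'B]; last first.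
      by have : (U' `&` B) b; [split=> //; exact: UU' | rewrite U'B].
    have : ~ closure U x.
      move=> clUx; have : (closure U' `&` A) x by split=> //; exact: (closureS UU').
      by rewrite clU'A.
    by move/notin_closureP; apply: filterS.
  have nQN := near_finite_forall finN nearU.
  move: (near_open oN Nx) nQN; apply: filterS2 => y Ny Qy [U [VU UB] Uy].
  by apply: (Qy U) => //; split=> //; exists y.
Qed.

(** The previous lemma surrounds [A] while avoiding the point [b], with neighbourhoods from the
    Hausdorff property; the complement of the closure obtained is [U]. *)
Lemma paracompact_regular (A : set X) b : closed A -> ~ A b ->
  exists U, [/\ open U, U b & closure U `&` A = set0].
Proof.
move=> clA nAb.
have [||G [oG AG clGb]] := @paracompact_separate [set b] A.
- by [].
- move=> a Aa; have ab : a != b by apply: contra_notN nAb => /eqP <-.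
  have := pX.1; rewrite open_hausdorff => /(_ _ _ ab)[[U V] /=].
  rewrite !in_setE => -[Ua Vb] [oU oV UV0].
  exists U; split=> //; rewrite -subset0 => c [clUc /= cb]; move: clUc; rewrite cb.
  apply/notin_closureP; apply: filterS (near_open oV Vb) => y Vy Uy.
  by have : (@set0 X) y by rewrite -UV0.
exists (~` closure G); split.
- by rewrite openC; exact: closed_closure.
- by move=> clb; have : (closure G `&` [set b]) b by []; rewrite clGb.
- rewrite -subset0 => c [clc Ac]; apply: (_ : ~ closure _ c) clc.
  apply/notin_closureP; apply: filterS (near_open oG (AG _ Ac)) => y Gy.
  by apply; exact: subset_closure.
Qed.

Lemma paracompact_normal : normal_space X.
Proof.
apply/(@normal_openP RR) => A B clA clB AB0.
have [b Bb|G [oG BG clGA]] := @paracompact_separate A B clB.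
  apply: paracompact_regular => // Ab; by have : (A `&` B) b by []; rewrite AB0.
exists (~` closure G), G; split=> //.
- by rewrite openC; exact: closed_closure.
- by move=> a Aa clGa; have : (closure G `&` A) a by []; rewrite clGA.
- by rewrite -subset0 => x [ncl Gx]; apply: ncl; exact: subset_closure.
Qed.

(** By regularity a locally finite refinement has members with closure in some [W i]. Collecting
    these members under a chosen index preserves this, since closure commutes with locally finite
    unions. *)
Lemma paracompact_shrink (I : choiceType) (W : I -> set X) :
  (forall i, open (W i)) -> (forall x, exists i, W i x) ->
  exists O : I -> set X, [/\ forall i, open (O i), forall x, exists i, O i x,
    locally_finite_indexed O & forall i, closure (O i) `<=` W i].
Proof.
move=> oW covW.
pose F := [set U | open U /\ exists i, closure U `<=` W i].
have covF : \bigcup_(U in F) U = setT.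
  rewrite eqEsubset; split => // x _; have [i Wix] := covW x.
  have [||U [oU Ux UW]] := @paracompact_regular (~` W i) x.
  - by rewrite closedC.
  - by [].
  - by exists U => //; split=> //; exists i; move/disjoints_subset: UW; rewrite setCK.
have [|V [oV [Vcov [Vref Vlf]]]] := pX.2 F _ covF; first by move=> U [].
have [[x0]|X0] := pselect (inhabited X); last first.
  by exists W; split=> // [x|i x]; exfalso; apply: X0.
have [i0 _] := covW x0.
have /choice[c cP] : forall U, exists i, V U -> closure U `<=` W i.
  move=> U; have [VU|nVU] := pselect (V U); last by exists i0.
  have [U' [[_ [i U'W]] UU']] := Vref U VU.
  by exists i => _; apply: subset_trans U'W; exact: closureS.
pose O i := \bigcup_(U in [set U | V U /\ c U = i]) U.
have finO x : exists N, [/\ open N, N x & finite_set [set U | V U /\ U `&` N !=set0]].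
  by have [N [oN [Nx finN]]] := Vlf x; exists N.
exists O; split.
- by move=> i; apply: bigcup_open => U [/oV].
- move=> x; have [U VU Ux] : (\bigcup_(U in V) U) x by rewrite Vcov.
  by exists (c U), U.
- move=> x; have [N [oN Nx finN]] := finO x.
  exists N; first exact: near_open.
  apply: sub_finite_set (finite_image c finN) => i [y [[U [VU cU] Uy] Ny]].
  by exists U => //; split=> //; exists y.
- move=> i x; apply: contraPP => nWx; apply/notin_closureP.
  have [N [oN Nx finN]] := finO x.
  have nearU U : V U /\ U `&` N !=set0 -> \forall y \near x, c U = i -> ~ U y.
    move=> [VU _]; have [cUi|] := pselect (c U = i); last first.
      by move=> ncU; apply: nearW => y /ncU.
    have : ~ closure U x by move/(cP U VU); rewrite cUi.
    by move/notin_closureP; apply: filterS.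
  have nQN := near_finite_forall finN nearU.
  move: (near_open oN Nx) nQN; apply: filterS2 => y Ny Qy [U [VU cU] Uy].
  by apply: (Qy U) => //; split=> //; exists y.
Qed.

(** Two successive shrinkings leave room for Urysohn functions. Unlike in a partition of unity, at
    each point the maximum, not the sum, is 1. *)
Lemma paracompact_bumps (I : choiceType) (W : I -> set X) :
  (forall i, open (W i)) -> (forall x, exists i, W i x) ->
  exists f : I -> X -> RR, [/\ forall i, continuous (f i),
    forall i x, 0 <= f i x <= 1, forall x, exists i, f i x = 1,
    forall i, [set x | f i x != 0] `<=` W i &
    locally_finite_indexed (fun i => [set x | f i x != 0])].
Proof.
move=> oW covW.
have [ O [oO covO lfO OW]] := paracompact_shrink oW covW.
have [P [oP covP lfP PO]] := paracompact_shrink oO covO.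
have /choice[f fP] : forall i, exists f : X -> RR, [/\ continuous f,
    forall x, 0 <= f x <= 1, forall x, P i x -> f x = 1 &
    [set x | f x != 0] `<=` O i].
  move=> i; have : uniform_separator (~` O i) (closure (P i)).
    apply: (@normal_separatorP RR _).1 paracompact_normal _ _ _ _ _.
    - by rewrite closedC.
    - exact: closed_closure.
    - by rewrite setIC; apply/disjoints_subset; rewrite setCK.
  move/(@uniform_separatorP _ RR) => [f [cf f01 f0 f1]].
  exists f; split=> //.
  - by move=> x; have := f01 (f x); rewrite /= in_itv /=; apply; exists x.
  - by move=> x Px; apply: f1; exists x => //; exact: subset_closure.
  - move=> x /=; apply: contra_neqP => nOx; apply: f0; by exists x.
exists f; split.
- by move=> i; have [] := fP i.
- by move=> i; have [] := fP i.
- by move=> x; have [i Px] := covP x; exists i; have [_ _ + _] := fP i; apply.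
- move=> i x fx; apply: OW; apply: subset_closure; have [_ _ _] := fP i; exact.
- by apply: locally_finite_subset lfO => i; have [] := fP i.
Qed.
End Paracompact.

(** * Disjoint refinements *)

(* A splits into disjoint open pieces, each inside a member of W; the piece
   around x is labelled by c x. *)
Definition disjointly_refines (X : topologicalType) (I : Type) (W : I -> set X)
    (A : set X) :=
  open A /\ exists c : X -> I, forall x, A x ->
    W (c x) x /\ \forall y \near x, c y = c x.

Section DisjointlyRefines.
Variable X : topologicalType.

Lemma disjointly_refines_const (I : Type) (W : I -> set X) (A : set X) i :
  open A -> A `<=` W i -> disjointly_refines W A.
Proof.
move=> oA AW; split=> //; exists (fun=> i) => x Ax; split; first exact: AW.
exact: nearW.
Qed.

Lemma disjointly_refines_sub (I : Type) (W : I -> set X) (A B : set X) :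
  disjointly_refines W A -> open B -> B `<=` A -> disjointly_refines W B.
Proof. by move=> [_ [c cP]] oB BA; split=> //; exists c => x /BA /cP. Qed.

Lemma disjointly_refines_reindex (I J : Type) (W : I -> set X) (W' : J -> set X)
    (A : set X) (g : I -> J) : (forall i, W i `<=` W' (g i)) ->
  disjointly_refines W A -> disjointly_refines W' A.
Proof.
move=> WW' [oA [c cP]]; split=> //; exists (g \o c) => x /cP[Wx ncx].
split; first exact: WW'.
by apply: filterS ncx => y /= ->.
Qed.

Lemma disjointly_refines_trans (I J : Type) (W : I -> set X) (O : J -> set X)
    (A : set X) : (forall j, disjointly_refines W (O j)) ->
  disjointly_refines O A -> disjointly_refines W A.
Proof.
move=> WO [oA [c cP]]; split=> //.
have /choice[d dP] : forall j, exists d : X -> I, forall x, O j x ->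
    W (d x) x /\ \forall y \near x, d y = d x by move=> j; have [] := WO j.
exists (fun x => d (c x) x) => x /cP[Ox ncx]; have [Wx ndx] := dP _ _ Ox.
by split=> //; move: ncx ndx; apply: filterS2 => y ->.
Qed.

(** The sets [A j] are open and disjoint, so the index of the one containing a point is locally
    constant and the labellings glue. *)
Lemma disjointly_refines_bigcup (I J : Type) (W : I -> set X) (A : J -> set X)
    (j0 : J) : (forall j j' x, A j x -> A j' x -> j = j') ->
  (forall j, disjointly_refines W (A j)) ->
  disjointly_refines W (\bigcup_j A j).
Proof.
move=> trA WA; split; first by apply: bigcup_open => j _; have [] := WA j.
have /choice[d dP] : forall j, exists d : X -> I, forall x, A j x ->
    W (d x) x /\ \forall y \near x, d y = d x by move=> j; have [] := WA j.
have /choice[s sP] : forall x, exists j, (\bigcup_j A j) x -> A j x.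
  move=> x; have [[j _ Ajx]|nx] := pselect ((\bigcup_j A j) x); last by exists j0.
  by exists j.
exists (fun x => d (s x) x) => x /sP Ax; have [Wx ndx] := dP _ _ Ax.
split=> //; have [oA _] := WA (s x).
move: ndx (near_open oA Ax); apply: filterS2 => y dy Ay.
by rewrite (trA (s y) (s x) y) //; apply: sP; exists (s x).
Qed.

Lemma near_lt_continuous (f g : X -> RR) x : continuous f -> continuous g ->
  f x < g x -> \forall y \near x, f y < g y.
Proof.
move=> cf cg fg; have cfg : (g y - f y) @[y --> x] --> g x - f x.
  exact: cvgB (cg x) (cf x).
have : 0 < g x - f x by rewrite subr_gt0.
by move/(cvgr_gt _ cfg); apply: filterS => y; rewrite subr_gt0.
Qed.

(** * Disjoint regions where given bump functions dominate *)

Section MaximalSupport.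
Variables (I : choiceType) (f : I -> X -> RR).
Hypothesis (cf : forall i, continuous (f i)).
Hypothesis (lf : locally_finite_indexed (fun i => [set x | f i x != 0])).

(* The points at which S collects the largest values of f; sets S of equal
   cardinality are incomparable, hence give disjoint regions. *)
Definition dominant_region (S : {fset I}) : set X :=
  [set x | forall i, i \in S -> 0 < f i x /\ forall j, j \notin S -> f j x < f i x].

Lemma open_dominant_region S : open (dominant_region S).
Proof.
apply: open_from_near => x Vx.
apply: (@near_finite_forall _ _ _ [set` S]); first exact: finite_fset.
move=> i /= iS; have [fi fij] := Vx i iS.
have nfi : \forall y \near x, 0 < f i y.
  by have := near_lt_continuous (@cst_continuous _ _ 0) (@cf i) fi.
(* The premise [0 < f i y] makes the inequality automatic where [f j] vanishes, so that local
   finiteness applies. *)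
have nfij : \forall y \near x, forall j, 0 < f i y -> j \notin S -> f j y < f i y.
  apply: (locally_finite_near lf) => [j y /= /negP|j].
    by rewrite negbK => /eqP ->.
  have [jS|jS] := boolP (j \in S); first by apply: nearW.
  by apply: filterS (near_lt_continuous (@cf j) (@cf i) (fij j jS)).
move: nfi nfij; apply: filterS2 => y fiy fijy; split=> // j; exact: fijy.
Qed.

(** The condition [0 < r] excludes the empty [S], whose region is the whole space. *)
Definition dominant_level (r : nat) : set X :=
  \bigcup_S [set x | [/\ (0 < r)%N, #|` S| = r & dominant_region S x]].

Lemma dominant_level_refines (i0 : I) r :
  disjointly_refines (fun i => [set x | f i x != 0]) (dominant_level r).
Proof.
apply: disjointly_refines_bigcup => [|S S' x [_ cS VS] [_ cS' VS']|S].
- exact: fset0.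
- have [SS'|] := boolP (fsubset S S').
    by apply/(@eqP {fset I} S S'); rewrite eqEfcard SS' cS cS' leqnn.
  have [S'S _|] := boolP (fsubset S' S).
    by apply/esym/(@eqP {fset I} S' S); rewrite eqEfcard S'S cS cS' leqnn.
  move=> /fsubsetPn[j jS' jS] /fsubsetPn[i iS iS'].
  have := (VS i iS).2 j jS; have := (VS' j jS').2 i iS'.
  by move=> /lt_trans /[apply]; rewrite ltxx.
- have [[r0 cS]|nS] := pselect ((0 < r)%N /\ #|` S| = r); last first.
    apply: (@disjointly_refines_const _ _ _ i0) => [|x [r0 cS _]]; last first.
      by exfalso; apply: nS.
    by apply: open_from_near => x [r0 cS _]; exfalso; apply: nS.
  have [i iS] : exists i, i \in S by apply/fset0Pn; rewrite -cardfs_gt0 cS.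
  apply: (@disjointly_refines_const _ _ _ i) => [|x [_ _ Vx]]; last first.
    by have [/lt0r_neq0] := Vx i iS.
  apply: open_from_near => x [_ _ Vx].
  by apply: filterS (near_open (open_dominant_region _) Vx).
Qed.

Lemma dominant_levelP (S : {fset I}) x : (0 < #|` S|)%N ->
  dominant_region S x -> dominant_level #|` S| x.
Proof. by move=> S0 Vx; exists S. Qed.

End MaximalSupport.
End DisjointlyRefines.

(** * Countable normal form of open covers, and the finite C-property for open sets *)

Section NormalForm.
Variables (X : topologicalType) (pX : paracompact X).

Lemma locally_finite_sum_near (I : choiceType) (f : I -> X -> RR) (x : X) :
  locally_finite_indexed (fun i => [set x | f i x != 0]) ->
  exists E : {fset I}, \forall y \near x,
    (forall i, i \notin E -> f i y = 0) /\
    \sum_(i \in setT) f i y = \sum_(i <- E) f i y.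
Proof.
move=> lf; have [N Nx /finite_fsetP[E EP]] := lf x; exists E.
apply: filterS Nx => y Ny.
have f0 i : i \notin E -> f i y = 0.
  apply: contraNeq => fi0; have : [set i | [set x | f i x != 0] `&` N !=set0] i.
    by exists y.
  by rewrite EP.
split=> //; exact: fsbigTE.
Qed.

(** The function [h] is the sum of a family of bump functions for [W], and [O r] is the region where
    exactly [r] of them dominate all the others. *)
Lemma cover_normal_form (I : choiceType) (W : I -> set X) :
  (forall i, open (W i)) -> (forall x, exists i, W i x) ->
  exists (O : nat -> set X) (h : X -> RR),
    [/\ forall r, disjointly_refines W (O r), continuous h,
        forall x, 0 <= h x &
        forall x r, h x < r.+1%:R -> exists q, (q <= r)%N /\ O q x].
Proof.
move=> oW covW; have [[x0]|X0] := pselect (inhabited X); last first.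
  have /choice[c _] : forall x : X, exists i : I, True.
    by move=> x; case: X0; exists.
  exists (fun=> set0), (fun=> 0); split=> [r|x|x|x]; try by case: X0; exists.
  by split; [exact: open0 | exists c].
have [i0 _] := covW x0.
have [f [cf f01 f1 fW lf]] := paracompact_bumps pX oW covW.
exists (dominant_level f), (fun x => \sum_(i \in setT) f i x); split.
- move=> r; apply: disjointly_refines_reindex (dominant_level_refines cf lf i0 r).
  exact: fW.
- move=> x; have [E Ex] := locally_finite_sum_near x lf.
  have [_ hx] := nbhs_singleton Ex.
  suff : (fun y => \sum_(i \in setT) f i y) @ x --> \sum_(i <- E) f i x.
    by rewrite -hx.
  apply: (@cvg_trans _ ((fun y => \sum_(i <- E) f i y) @ x)).
    apply: near_eq_cvg; apply: filterS Ex => y [_ ->] //.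
  by apply: (cvg_big add_continuous) => i _; exact: cf.
- move=> x; have [E Ex] := locally_finite_sum_near x lf.
  have [_ ->] := nbhs_singleton Ex; apply: sumr_ge0 => i _.
  by have /andP[] := f01 i x.
- move=> x r hr; have [E Ex] := locally_finite_sum_near x lf.
  have [f0 hE] := nbhs_singleton Ex; rewrite hE in hr.
  (* The indices at which the maximal value 1 is attained dominate the others; each contributes 1 to
     [h x], so there are at most [r] of them. *)
  pose S := [fset i in E | f i x == 1]%fset.
  have [i fi1] := f1 x.
  have iS : i \in S.
    rewrite !inE fi1 eqxx andbT; apply/negPn/negP => /f0; rewrite fi1.
    by move/eqP; rewrite oner_eq0.
  exists #|` S|; split; last first.
    apply: dominant_levelP; first by rewrite cardfs_gt0; apply/fset0Pn; exists i.
    move=> j; rewrite !inE /= => /andP[_ /eqP ->]; split=> // k.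
    rewrite !inE /=; have [kE /= fk1|/f0 -> _ //] := boolP (k \in E).
    by have /andP[_] := f01 k x; rewrite le_eqVlt (negPf fk1).
  rewrite -ltnS -(ltr_nat RR); apply: le_lt_trans hr.
  rewrite card_fset_sum1 natr_sum /S -big_fset_condE /=.
  rewrite [leLHS]big_mkcond. apply: ler_sum => k _; case: ifP => [/eqP -> //|_].
  by have /andP[] := f01 k x.
Qed.

(** Bump functions replace the open covers by covers with cozero sets; disjointness of [gamma n]
    makes the label of the member containing a point locally constant. *)
Lemma finite_C_open (fC : finite_C_space X) (W : nat -> nat -> set X)
    (N : nat -> nat) :
  (forall n i, open (W n i)) -> (forall n x, exists i, (i < N n)%N /\ W n i x) ->
  exists (k : nat) (A : nat -> set X),
    (forall x, exists n, (n < k)%N /\ A n x) /\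
    forall n, (n < k)%N ->
      disjointly_refines (fun i => [set x | (i < N n)%N /\ W n i x]) (A n).
Proof.
(* With the bound built in, indices from [N n] on label empty sets. *)
move=> oW covW; pose W' n i := [set x | (i < N n)%N /\ W n i x].
have oW' n i : open (W' n i).
  apply: open_from_near => x [iN Wx].
  by apply: filterS (near_open (oW n i) Wx) => y Wy.
have /choice[f fP] : forall n, exists f : nat -> X -> RR,
    [/\ forall i, continuous (f i), forall x, exists i, f i x = 1 &
        forall i, [set x | f i x != 0] `<=` W' n i].
  move=> n; have [f [cf f01 f1 fW lf]] := paracompact_bumps pX (oW' n) (covW n).
  by exists f.
pose omega n := [set [set x | f n i x != 0] | i in `I_(N n)].
have [n|k [gamma [gP covg]]] := fC omega.
  have [cf f1 fW] := fP n; split; first exact/finite_image/finite_II.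
  split=> [_ [i _ <-]|]; first by exists (f n i).
  rewrite eqEsubset; split=> // x _; have [i fi1] := f1 x.
  have fi0 : f n i x != 0 by rewrite fi1 oner_neq0.
  exists [set x | f n i x != 0] => //; exists i => //.
  by have [] := fW i x fi0.
exists k, (fun n => \bigcup_(U in gamma n) U); split=> [x|n nk].
  have : [set: X] x by [].
  by rewrite -covg => -[n nk gx]; exists n.
have [fing [og [dg refg]]] := gP n nk.
have oU U : gamma n U -> open U.
  move=> /og[g [cg ->]]; apply: (open_comp (D := [set t : RR | t != 0])).
    by move=> x _; exact: cg.
  exact: open_neq.
split; first by apply: bigcup_open => U /oU.
have /choice[c cP] : forall U, exists i, gamma n U -> U `<=` W' n i.
  move=> U; have [gU|ngU] := pselect (gamma n U); last by exists 0%N.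
  have [_ [[i _ <-] Ui]] := refg U gU; exists i => _.
  by apply: subset_trans Ui _; have [_ _] := fP n; apply.
have /choice[d dP] : forall x, exists U, (\bigcup_(U in gamma n) U) x ->
    gamma n U /\ U x.
  move=> x; have [[U gU Ux]|nx] := pselect ((\bigcup_(U in gamma n) U) x).
    by exists U.
  by exists set0.
exists (c \o d) => x /dP[gd dx]; split; first exact: (cP _ gd).
apply: filterS (near_open (oU _ gd) dx) => y dy /=; congr c.
have [gd' d'y] : gamma n (d y) /\ d y y by apply: dP; exists (d x).
apply: contrapT => /(dg _ _ gd' gd) dd.
by have : (d y `&` d x) y by []; rewrite dd.
Qed.
End NormalForm.

(** * Dimension of slices and the C-property for infinite covers *)

Section Slices.
Variables (X : topologicalType) (pX : paracompact X).

(* For a closed subset of a normal space this amounts to dim E < d. *)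
Definition shrinks_to_empty_meet (d : nat) (E : set X) :=
  forall U : nat -> set X, (forall i, open (U i)) ->
    (forall x, E x -> exists i, (i <= d)%N /\ U i x) ->
    exists W : nat -> set X, [/\ forall i, open (W i), forall i, W i `<=` U i,
      forall x, E x -> exists i, (i <= d)%N /\ W i x &
      forall x, E x -> exists i, (i <= d)%N /\ ~ W i x].

(** Adding the complement of [F] to each member turns a cover of [F] into one of [E] and changes
    nothing on [F]. *)
Lemma shrinks_to_empty_meet_closed d (E F : set X) : closed F -> F `<=` E ->
  shrinks_to_empty_meet d E -> shrinks_to_empty_meet d F.
Proof.
move=> clF FE sE U oU covU.
have [||W [oW WU covW meetW]] := sE (fun i => U i `|` ~` F).
- by move=> i; apply: openU => //; rewrite openC.
- move=> x Ex; have [/covU[i [id Ux]]|nFx] := pselect (F x).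
    by exists i; split=> //; left.
  by exists 0%N; split=> //; right.
- exists (fun i => W i `&` U i); split.
  + by move=> i; exact: openI.
  + by move=> i x [].
  + move=> x Fx; have [i [id Wx]] := covW x (FE x Fx).
    by exists i; split=> //; split=> //; case: (WU i x Wx).
  + move=> x Fx; have [i [id Wx]] := meetW x (FE x Fx).
    by exists i; split=> // -[].
Qed.

Definition slice (h : X -> RR) (i : nat) : set X :=
  [set x | i%:R <= h x <= i.+1%:R].

Lemma closed_slice (h : X -> RR) i : continuous h -> closed (slice h i).
Proof.
move=> ch; have -> : slice h i = h @^-1` `[i%:R, i.+1%:R]%classic.
  by rewrite eqEsubset; split=> x; rewrite /slice /= in_itv.
by apply: preimage_closed; [move=> x _; exact: ch | exact: interval_closed].
Qed.

Lemma locally_finite_slice (h : X -> RR) : continuous h ->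
  locally_finite_indexed (slice h).
Proof.
move=> ch x; exists [set y | h y < h x + 1].
  have hx : h x < h x + 1 by rewrite ltrDl.
  exact: near_lt_continuous ch (@cst_continuous _ _ (h x + 1)) hx.
apply: sub_finite_set (finite_II (Num.bound `|h x + 1|)).
move=> i [y [/andP[iy _] /= yx]] /=; rewrite -(ltr_nat RR).
apply: le_lt_trans iy (lt_le_trans yx _); apply: le_trans (ler_norm _) _.
by apply/ltW/archi_boundP.
Qed.

(** The enlarged slices [i - 1/2 < h < i + 3/2] with [i] of one parity are disjoint, so their
    families merge rank by rank. Even slices use the ranks below [D], odd ones the ranks from [D]
    on. *)
Lemma slice_cover_union (h : X -> RR) (I : Type) (W : I -> set X)
    (E : nat -> set X) (D : nat) : continuous h ->
  (forall i, E i `<=` slice h i) ->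
  (forall i, exists A : nat -> set X, (forall r, disjointly_refines W (A r)) /\
    forall x, E i x -> exists r, (r < D)%N /\ A r x) ->
  exists A : nat -> set X, (forall r, disjointly_refines W (A r)) /\
    forall i x, E i x -> exists r, (r < D + D)%N /\ A r x.
Proof.
move=> ch Eh /choice[A AP].
pose C r i := [set x | [/\ odd i = (D <= r)%N, i%:R - 2^-1 < h x,
  h x < i%:R + 1 + 2^-1 & A i (if (D <= r)%N then r - D else r)%N x]].
exists (fun r => \bigcup_i C r i); split=> [r|i x Ex].
  apply: disjointly_refines_bigcup => [|i i' x|i]; first exact: 0%N.
    move=> [oi ix xi _] [oi' ix' xi' _].
    have ii' : (i < i' + 2)%N.
      by rewrite -(ltr_nat RR) natrD; lra.
    have i'i : (i' < i + 2)%N.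
      by rewrite -(ltr_nat RR) natrD; lra.
    by move: oi; rewrite -oi' => oo; lia.
  apply: disjointly_refines_sub ((AP i).1 _) _ _; last by move=> x [_ _ _]; exact.
  apply: open_from_near => x [oi ix xi Ax].
  have nix := near_lt_continuous (@cst_continuous _ _ _) ch ix.
  have nxi := near_lt_continuous ch (@cst_continuous _ _ _) xi.
  have nA := near_open ((AP i).1 _).1 Ax.
  by move: nix nxi nA; apply: filterS3 => y; split.
have [r [rD Ax]] := (AP i).2 x Ex; have /andP[ix xi] := Eh i x Ex.
rewrite -natr1 in xi; have [oi|ei] := boolP (odd i).
  exists (r + D)%N; split; first by rewrite ltn_add2r.
  by exists i => //; split; rewrite ?leq_addl ?addnK//; lra.
exists r; split; first by rewrite ltn_addr.
by exists i => //; split; rewrite ?(negPf ei) ?[(D <= r)%N]leqNgt ?rD//; lra.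
Qed.
End Slices.

(** * Bounded dimension of far slices in a finite C-space *)

Section Dimension.
Variables (X : topologicalType) (pX : paracompact X).

(* The complement of E is added to the cover. *)
Lemma closed_bumps (I : choiceType) (E : set X) (U : I -> set X) : closed E ->
  (forall i, open (U i)) -> (forall x, E x -> exists i, U i x) ->
  exists f : I -> X -> RR, [/\ forall i, continuous (f i),
    forall i x, 0 <= f i x <= 1, forall x, E x -> exists i, f i x = 1,
    forall i, [set x | f i x != 0] `<=` U i &
    locally_finite_indexed (fun i => [set x | f i x != 0])].
Proof.
move=> clE oU covU.
pose W (o : option I) := if o is Some i then U i else ~` E.
have oW o : open (W o) by case: o => [i|]; [exact: oU | rewrite /= openC].
have covW x : exists o, W o x.
  have [/covU[i Ux]|nEx] := pselect (E x); first by exists (Some i).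
  by exists None.
have [f [cf f01 f1 fW lf]] := paracompact_bumps pX oW covW.
exists (fun i => f (Some i)); split=> //.
- move=> x Ex; have [[i fx|fx]] := f1 x; first by exists i.
  by exfalso; apply: (fW None x) => //=; rewrite fx oner_neq0.
- move=> x; have [N Nx finN] := lf x; exists N => //.
  by apply: (finite_preimage (f := Some)) finN => i j _ _ [].
Qed.

(* If infinitely many slices had large dimension, two-element covers read off
   from essential families on slices far apart from each other would violate
   the finite C-property. *)
Lemma finite_C_slices (fC : finite_C_space X) (h : X -> RR) : continuous h ->
  exists j d, forall i, (j <= i)%N -> shrinks_to_empty_meet d (slice h i).
Proof.
move=> ch; apply: contrapT => nS.
have /choice[s sP] : forall j, exists t : nat -> nat, forall d,
    (j <= t d)%N /\ ~ shrinks_to_empty_meet d (slice h (t d)).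
  move=> j; have /choice[t tP] : forall d, exists i, (j <= i)%N /\
      ~ shrinks_to_empty_meet d (slice h i); last by exists t.
  move=> d; apply: contrapT => nd; apply: nS; exists j, d => i ji.
  by apply: contrapT => ni; apply: nd; exists i.
(* A gap of at least 2 makes the chosen closed slices disjoint, so a single cover can treat all of
   them at once. *)
pose idx := fix F d := if d is d'.+1 then s (F d' + 2)%N d else s 0%N 0%N.
have idxS d : (idx d + 2 <= idx d.+1)%N by have [] := sP (idx d + 2)%N d.+1.
have idx_lt d d' : (d < d')%N -> (idx d + 2 <= idx d')%N.
  elim: d' => // d' IH; rewrite ltnS leq_eqVlt => /orP[/eqP -> //|/IH].
  by move=> le_dd'; have := idxS d'; lia.
pose E d := slice h (idx d).
have nE d : ~ shrinks_to_empty_meet d (E d).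
  by rewrite /E; case: d => [|d]; [have [] := sP 0%N 0%N | have [] := sP (idx d + 2)%N d.+1].
have clE d : closed (E d) by apply: closed_slice.
have E_lt d d' x : (d < d')%N -> E d x -> ~ E d' x.
  move=> /idx_lt; rewrite -(ler_nat RR) natrD => dd' /andP[_ +] /andP[+ _].
  by rewrite -natr1; lra.
have E_inj d d' x : E d x -> E d' x -> d = d'.
  by case: (ltngtP d d') => // dd' Ed Ed'; [case: (E_lt _ _ x dd')|case: (E_lt _ _ x dd')].
have lfE : locally_finite_indexed E.
  move=> x; have [N Nx finN] := locally_finite_slice ch x; exists N => //.
  apply: (finite_preimage (f := idx)) finN => d d' _ _ dd'.
  by case: (ltngtP d d') => // /idx_lt; rewrite dd'; lia.
(* On [E d] the sets [U d 0], ..., [U d d] form an essential family. *)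
have /choice[U UP] : forall d, exists U : nat -> set X, [/\ forall i, open (U i),
    forall x, E d x -> exists i, (i <= d)%N /\ U i x &
    ~ exists W : nat -> set X, [/\ forall i, open (W i), forall i, W i `<=` U i,
      forall x, E d x -> exists i, (i <= d)%N /\ W i x &
      forall x, E d x -> exists i, (i <= d)%N /\ ~ W i x]].
  move=> d; apply: contrapT => nU; apply: (nE d) => U oU covU.
  by apply: contrapT => nW; apply: nU; exists U.
have /choice[f fP] : forall d, exists f : nat -> X -> RR,
    [/\ forall i, continuous (f i), forall x, E d x -> exists i, f i x = 1 &
        forall i, [set x | f i x != 0] `<=` [set x | (i <= d)%N /\ U d i x]].
  move=> d; have [oU covU _] := UP d.
  have [i|x Ex|f [cf _ f1 fU _]] :=
      @closed_bumps _ (E d) (fun i => [set x | (i <= d)%N /\ U d i x]) (clE d).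
  - by apply: open_from_near => x [id Ux]; apply: filterS (near_open (oU i) Ux).
  - by have [i [id Ux]] := covU x Ex; exists i.
  - by exists f.
(* On every [E d] with [n < d], the [n]-th cover separates large from small values of [f d n]; its
   two members overlap where the value lies between 1/3 and 2/3. *)
pose W n (b : nat) := [set x | forall d, E d x -> (n < d)%N ->
  if b == 0%N then 3^-1 < f d n x else f d n x < 2 / 3].
have oW n b : open (W n b).
  apply: open_from_near => x Wx.
  apply: (locally_finite_near lfE) => [d y nEy /nEy //|d].
  have [Ex|nEx] := pselect (E d x); last first.
    have : open (~` E d) by rewrite openC.
    by move=> /near_open /(_ nEx); apply: filterS => y nEy /nEy.
  have [nd|dn] := ltnP n d; last by apply: nearW.
  have [cf _ _] := fP d; have := Wx d Ex nd; case: ifP => b0 fx.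
    by have := near_lt_continuous (@cst_continuous _ _ _) (cf n) fx; apply: filterS.
  by have := near_lt_continuous (cf n) (@cst_continuous _ _ _) fx; apply: filterS.
have covW n x : exists b, (b < 2)%N /\ W n b x.
  have [[d Ex]|nE'] := pselect (exists d, E d x); last first.
    by exists 0%N; split=> // d Ex; exfalso; apply: nE'; exists d.
  have [fx|fx] := ltP 3^-1 (f d n x).
    by exists 0%N; split=> // d' Ex' _ /=; rewrite (E_inj _ _ _ Ex' Ex).
  exists 1%N; split=> // d' Ex' _ /=; rewrite (E_inj _ _ _ Ex' Ex).
  by apply: le_lt_trans fx _; lra.
have [k [A [covA WA]]] := finite_C_open pX fC (N := fun=> 2%N) oW covW.
(* The contradiction arises on [E k], whose essential family has one member more than there are
   families [A n]. *)
have [oU covU noW] := UP k; have [cf f1 fU] := fP k; apply: noW.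
have /choice[c cP] : forall n, exists c : X -> nat, (n < k)%N -> forall x, A n x ->
    W n (c x) x /\ \forall y \near x, c y = c x.
  move=> n; have [nk|kn] := ltnP n k; last by exists (fun=> 0%N).
  have [_ [c cP]] := WA n nk; exists c => _ x Ax.
  by have [[_ Wx] ncx] := cP x Ax.
(* Within [E k], the set [V n] contains the pieces of [A n] labelled 0 and misses the others, so its
   boundary avoids [A n]. *)
pose V n := [set x | 2 / 3 < f k n x \/ [/\ A n x, c n x = 0%N & 3^-1 < f k n x]].
have oV n : (n < k)%N -> open (V n).
  move=> nk; apply: open_from_near => x [fx|[Ax cx fx]].
    by apply: filterS (near_lt_continuous (@cst_continuous _ _ _) (cf n) fx); left.
  have nf := near_lt_continuous (@cst_continuous _ _ _) (cf n) fx.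
  have nA := near_open (WA n nk).1 Ax; have [_ nc] := cP n nk x Ax.
  by move: nf nA nc; apply: filterS3 => y fy Ay cy; right; split=> //; rewrite cy.
have VU n : V n `<=` U k n.
  move=> x Vx; have fx : f k n x != 0.
    by apply: lt0r_neq0; case: Vx => [|[_ _]]; lra.
  by have [] := fU n x fx.
pose C := [set x | E k x /\ forall n, (n < k)%N -> V n x].
(* The last set covers what the [V n] miss and avoids their common points: a point of [E k] in no
   [V n] has a neighbourhood without points of [C], found inside some [A n]. *)
exists (fun n => if (n < k)%N then V n else if n == k then U k k `&` ~` closure C
        else set0); split.
- move=> i; case: ifP => [/oV //|_]; case: ifP => _; last exact: open0.
  by apply: openI => //; rewrite openC; exact: closed_closure.
- move=> i; case: ifP => [ik|_]; first exact: VU.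
  by case: ifP => [/eqP ->|_] x // [].
- move=> x Ex; have [[n [nk Vx]]|nV] := pselect (exists n, (n < k)%N /\ V n x).
    by exists n; split; [exact: ltnW | rewrite nk].
  exists k; split=> //; rewrite ltnn eqxx; split.
    have [i fx] := f1 x Ex.
    have [ik Ux] : (i <= k)%N /\ U k i x by apply: fU; rewrite /= fx oner_neq0.
    move: ik; rewrite leq_eqVlt => /orP[/eqP ik|ik].
      by move: Ux; rewrite ik.
    by exfalso; apply: nV; exists i; split=> //; rewrite /V /= fx; left; lra.
  apply/notin_closureP; have [n [nk Ax]] := covA x.
  have [Wx nc] := cP n nk x Ax; have oA := near_open (WA n nk).1 Ax.
  have [c0|c0] := eqVneq (c n x) 0%N.
    exfalso; apply: nV; exists n; split=> //; rewrite /V /=; right; split=> //.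
    by have := Wx k Ex nk; rewrite c0.
  move: nc oA; apply: filterS2 => y cy Ay [Ey /(_ n nk) Vy].
  have [Wy _] := cP n nk y Ay; have := Wy k Ey nk; rewrite cy (negPf c0).
  by case: Vy => [|[_ + _]]; [lra | rewrite cy => c0'; rewrite c0' in c0].
- move=> x Ex; have [Cx|nCx] := pselect (forall n, (n < k)%N -> V n x).
    exists k; split=> //; rewrite ltnn eqxx => -[_]; apply.
    by apply: subset_closure.
  have [n [nk nV]] : exists n, (n < k)%N /\ ~ V n x.
    apply: contrapT => nn; apply: nCx => n nk; apply: contrapT => nV.
    by apply: nn; exists n.
  by exists n; split; [exact: ltnW | rewrite nk].
Qed.
End Dimension.

(** * Disjoint refinements on finite-dimensional parts, and infinite covers *)

Section FiniteDimensional.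
Variables (X : topologicalType) (pX : paracompact X).

(* Hemmingsen's argument: shrinking once for each colouring with
   d + 1 colours yields a cover of order at most d. *)
Lemma shrink_order (d N : nat) (E : set X) (O : 'I_N -> set X) :
  shrinks_to_empty_meet d E -> (forall i, open (O i)) ->
  (forall x, E x -> exists i, O i x) ->
  exists U : 'I_N -> set X, [/\ forall i, open (U i), forall i, U i `<=` O i,
    forall x, E x -> exists i, U i x &
    forall (c : {ffun 'I_N -> 'I_d.+1}) x, E x ->
      exists j, forall i, c i = j -> ~ U i x].
Proof.
move=> sE oO covO.
suff shr (s : seq {ffun 'I_N -> 'I_d.+1}) : exists U : 'I_N -> set X,
    [/\ forall i, open (U i), forall i, U i `<=` O i,
    forall x, E x -> exists i, U i x &
    forall c, c \in s -> forall x, E x -> exists j, forall i, c i = j -> ~ U i x].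
  have [U [oU UO covU Us]] := shr (enum {ffun 'I_N -> 'I_d.+1}).
  by exists U; split=> // c; apply: Us; rewrite mem_enum.
elim: s => [|c s [U [oU UO covU Us]]]; first by exists O; split=> // i x.
(* Members of one colour are merged; the shrinking of the [d + 1] merged sets is then imposed on the
   individual ones. *)
pose B j := \bigcup_(i in [set i | c i = j :> nat]) U i.
have [j|x Ex|W [oW WB covW meetW]] := sE B.
- by apply: bigcup_open.
- have [i Ux] := covU x Ex; exists (c i); split; first by rewrite -ltnS.
  by exists i.
exists (fun i => W (c i) `&` U i); split.
- by move=> i; apply: openI.
- by move=> i x [_ /UO].
- move=> x /covW[j [_ Wx]]; have [i /= ci Ux] := WB j x Wx.
  by exists i; rewrite ci.
- move=> c'; rewrite inE => /orP[/eqP -> x Ex|c's x Ex].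
    have [j [jd nW]] := meetW x Ex; exists (inord j) => i ci [+ _].
    by rewrite ci inordK ?ltnS // => /nW.
  by have [j nU] := Us c' c's x Ex; exists j => i ci [_]; exact: nU.
Qed.

(** If [d + 1] sets of the shrunk cover met at a point of [E], giving them all [d + 1] colours would
    contradict [shrink_order]. So at most [d] bump functions are positive there, and they form a
    dominant set. *)
Lemma shrinks_finite_cover (d N : nat) (E : set X) (O : nat -> set X) :
  closed E -> shrinks_to_empty_meet d E -> (forall i, open (O i)) ->
  (forall x, E x -> exists i, (i < N)%N /\ O i x) ->
  exists A : nat -> set X, (forall r, disjointly_refines O (A r)) /\
    forall x, E x -> exists r, (r < d.+1)%N /\ A r x.
Proof.
case: N => [|N] clE sE oO covO.
  exists (fun=> set0); split=> [r|x Ex]; last by have [i []] := covO x Ex.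
  exact: (@disjointly_refines_const _ _ _ _ 0%N open0).
have [i|x Ex|U [oU UO covU Uc]] := @shrink_order d N.+1 E (O \o val) sE.
- exact: oO.
- by have [i [iN Ox]] := covO x Ex; exists (Ordinal iN).
have [f [cf f01 f1 fU lf]] := closed_bumps pX clE oU covU.
exists (dominant_level f); split=> [r|x Ex].
  apply: disjointly_refines_reindex (dominant_level_refines cf lf ord0 r) => i.
  exact: subset_trans (fU i) (UO i).
pose S := [fset i : 'I_N.+1 | 0 < f i x]%fset.
have [i fx] := f1 x Ex.
exists #|` S|; split; last first.
  apply: dominant_levelP.
    by rewrite cardfs_gt0; apply/fset0Pn; exists i; rewrite !inE /= fx.
  move=> j; rewrite !inE /= => fj; split=> // k; rewrite !inE /= -leNgt => fk.
  exact: le_lt_trans fk fj.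
rewrite ltnNge; apply/negP => dS.
(* Elements of [S] are coloured by their position, capped at [d], so every colour occurs among
   them. *)
have [j nU] := Uc [ffun i => inord (minn (index i S) d)] x Ex.
have jS : (j < size S)%N by apply: leq_trans dS; exact: ltn_ord.
have /nU : [ffun i => inord (minn (index i S) d)] (nth ord0 S j) = j.
  rewrite ffunE index_uniq ?fset_uniq //; apply/val_inj => /=.
  have jd : (j <= d)%N by rewrite -ltnS.
  by rewrite inordK (minn_idPl jd).
apply; apply: fU => /=; have := mem_nth ord0 jS.
by rewrite !inE => /lt0r_neq0.
Qed.

(** On each slice of the function [h] of the normal form, finitely many [O r] suffice; merging the
    slices doubles the number of families. *)
Lemma shrinks_cover (d : nat) (E : set X) (I : choiceType) (W : I -> set X) :
  closed E -> shrinks_to_empty_meet d E -> (forall i, open (W i)) ->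
  (forall x, exists i, W i x) ->
  exists A : nat -> set X, (forall r, disjointly_refines W (A r)) /\
    forall x, E x -> exists r, (r < d.+1 + d.+1)%N /\ A r x.
Proof.
move=> clE sE oW covW; have [ O [h [WO ch h0 hO]]] := cover_normal_form pX oW covW.
have [i x []|i|A [WA covA]] := @slice_cover_union _ _ _ W
  (fun i => E `&` slice h i) d.+1 ch.
- by [].
- have clEi : closed (E `&` slice h i) by apply: closedI => //; exact: closed_slice.
  have sEi : shrinks_to_empty_meet d (E `&` slice h i).
    by apply: shrinks_to_empty_meet_closed sE => // x [].
  (* On this slice [h <= i + 1 < i + 2], so the members [O 0], ..., [O i.+1] cover it. *)
  have [r|x [_ /andP[_ xi]]|A [OA covA]] := @shrinks_finite_cover d i.+2 _ O clEi sEi.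
  + by have [] := WO r.
  + have [|q [qi Ox]] := hO x i.+1; last by exists q; rewrite ltnS.
    by apply: le_lt_trans xi _; rewrite ltr_nat.
  + by exists A; split=> // r; exact: disjointly_refines_trans (OA r).
exists A; split=> // x Ex; apply: (covA (Num.truncn (h x)) x); split=> //.
by have /andP[hx /ltW xh] := truncn_itv (h0 x); apply/andP.
Qed.

(* Unlike in the definition of finite C-spaces, the covers may be infinite. *)
Definition c_refinable (A : set X) := forall W : nat -> X -> set X,
  (forall n i, open (W n i)) -> (forall n x, exists i, W n i x) ->
  exists (K : nat) (B : nat -> set X),
    (forall m, (m < K)%N -> disjointly_refines (W m) (B m)) /\
    forall x, A x -> exists m, (m < K)%N /\ B m x.

(** The first [K] covers serve [A], and those from index [K] on serve [B]. *)
Lemma c_refinableU (A B : set X) :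
  c_refinable A -> c_refinable B -> c_refinable (A `|` B).
Proof.
move=> rA rB W oW covW; have [K [C [WC covC]]] := rA W oW covW.
have [L [D [WD covD]]] := rB (fun m => W (K + m)%N) (fun=> oW _) (fun=> covW _).
exists (K + L)%N, (fun m => if (m < K)%N then C m else D (m - K)%N); split.
  move=> m mKL; case: ltnP => [/WC //|Km].
  by rewrite -{1}(subnKC Km); apply: WD; lia.
move=> x [/covC[m [mK Cx]]|/covD[m [mL Dx]]].
  by exists m; rewrite mK ltn_addr.
by exists (K + m)%N; rewrite ltn_add2l [(K + m < K)%N]ltnNge leq_addr /= addKn.
Qed.

Lemma c_refinable_bigcup (T : nat -> set X) k :
  (forall n, (n < k)%N -> c_refinable (T n)) ->
  c_refinable [set x | exists n, (n < k)%N /\ T n x].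
Proof.
elim: k => [|k IH] rT.
  move=> W oW covW; exists 0%N, (fun=> set0); split=> // x [n []] //.
have rk := c_refinableU (IH (fun n nk => rT n (ltnW nk))) (rT k (ltnSn k)).
move=> W oW covW; have [K [B [WB covB]]] := rk W oW covW.
exists K, B; split=> // x [n []]; rewrite ltnS leq_eqVlt => /orP[/eqP -> Tx|nk Tx].
  by apply: covB; right.
by apply: covB; left; exists n.
Qed.

(* D covers are handled at once through their common refinement. *)
Lemma c_refinable_bounded (D : nat) (T : set X) :
  (forall W : X -> set X, (forall i, open (W i)) -> (forall x, exists i, W i x) ->
    exists A : nat -> set X, (forall r, disjointly_refines W (A r)) /\
    forall x, T x -> exists r, (r < D)%N /\ A r x) ->
  c_refinable T.
Proof.
move=> bT W oW covW.
have /choice[s sP] : forall n, exists s : X -> X, forall x, W n (s x) x.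
  by move=> n; have /choice[s sP] := covW n; exists s.
pose V x := [set y | forall n, (n < D)%N -> W n (s n x) y].
have [x|x|A [VA covA]] := bT V.
- apply: open_from_near => y Vy.
  apply: (@near_finite_forall _ _ _ `I_D) => [|n nD]; first exact: finite_II.
  exact: near_open (oW _ _) (Vy n nD).
- by exists x => n _.
exists D, A; split=> // m mD.
by apply: disjointly_refines_reindex (VA m) => x y; exact.
Qed.

(** Each slice takes [2(d + 1)] families and their union twice as many, a bound independent of the
    cover. *)
Lemma c_refinable_shrinks_slices (h : X -> RR) (j d : nat) : continuous h ->
  (forall i, (j <= i)%N -> shrinks_to_empty_meet d (slice h i)) ->
  c_refinable [set x | j%:R <= h x].
Proof.
move=> ch sh; apply: (@c_refinable_bounded ((d.+1 + d.+1) + (d.+1 + d.+1))).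
move=> W oW covW.
have [i x []|i|A [WA covA]] := @slice_cover_union _ _ _ W
  (fun i => [set x | (j <= i)%N /\ slice h i x]) (d.+1 + d.+1) ch.
- by [].
- have [ji|ij] := leqP j i; last first.
    exists (fun=> set0); split=> [r|x]; last by move=> [].
    split; first exact: open0.
    by have /choice[c _] := covW; exists c.
  have [A [WA covA]] := shrinks_cover (closed_slice (i := i) ch) (sh i ji) oW covW.
  by exists A; split=> // x [_ /covA].
exists A; split=> // x /= jx; apply: (covA (Num.truncn (h x)) x); split.
  by rewrite truncn_ge_nat // (le_trans _ jx).
by have /andP[hx /ltW xh] := truncn_itv (le_trans (ler0n _ _) jx); apply/andP.
Qed.

(* On the part where h n < j n + 1 the n-th cover is finite up to a disjoint
   splitting; the remaining part is finite-dimensional and is covered by means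
   of later covers. *)
Lemma finite_C_refinable : finite_C_space X -> c_refinable setT.
Proof.
move=> fC W oW covW.
have /choice[S SP] : forall n, exists S : (nat -> set X) * (X -> RR) * nat,
    [/\ forall r, disjointly_refines (W n) (S.1.1 r), continuous S.1.2,
     forall x r, S.1.2 x < r.+1%:R -> exists q, (q <= r)%N /\ S.1.1 q x &
     c_refinable [set x | S.2%:R <= S.1.2 x]].
  move=> n; have [ O [h [WO ch _ hO]]] := cover_normal_form pX (oW n) (covW n).
  have [j [d sd]] := finite_C_slices pX fC ch.
  by exists (O, h, j); split=> //; exact: c_refinable_shrinks_slices sd.
pose O n := (S n).1.1; pose h n := (S n).1.2; pose j n := (S n).2.
(* The sets [O n r] with [r <= j n] cover the part [h n < j n + 1]; all later indices denote the
   remaining part, and the first of them completes a finite cover. *)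
pose V n r := if (r <= j n)%N then O n r else [set x | (j n)%:R < h n x].
have oV n r : open (V n r).
  have [WO ch _ _] := SP n; rewrite /V; case: ifP => _; first by have [] := WO r.
  by apply: open_from_near => x; exact: near_lt_continuous (@cst_continuous _ _ _) ch.
have covV n x : exists r, (r < (j n).+2)%N /\ V n r x.
  have [_ _ hO _] := SP n; have [/hO[q [qj Ox]]|hx] := ltP (h n x) (j n).+1%:R.
    by exists q; rewrite /V qj; split=> //; rewrite ltnS ltnW.
  exists (j n).+1; rewrite /V ltnn; split=> //=.
  by apply: lt_le_trans hx; rewrite ltr_nat.
have [k [A [covA VA]]] := finite_C_open pX fC oV covV.
have /choice[c cP] : forall n, exists c : X -> nat, (n < k)%N -> forall x, A n x ->
    V n (c x) x /\ \forall y \near x, c y = c x.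
  move=> n; have [nk|kn] := ltnP n k; last by exists (fun=> 0%N).
  have [_ [c cP]] := VA n nk; exists c => _ x Ax.
  by have [[_ Wx] ncx] := cP x Ax.
(* Pieces labelled by some [O n r] are kept; the others lie in [h n > j n] and are left to the
   covers from index [k] on. *)
pose B n := [set x | A n x /\ (c n x <= j n)%N].
have OB n : (n < k)%N -> disjointly_refines (O n) (B n).
  move=> nk; split.
    apply: open_from_near => x [Ax cx]; have [_ nc] := cP n nk x Ax.
    by move: (near_open (VA n nk).1 Ax) nc; apply: filterS2 => y Ay cy; split; rewrite ?cy.
  exists (c n) => x [Ax cx]; have [Vx nc] := cP n nk x Ax; split=> //.
  by move: Vx; rewrite /V cx.
have rT : c_refinable [set x | exists n, (n < k)%N /\ (j n)%:R <= h n x].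
  by apply: c_refinable_bigcup => n _; have [] := SP n.
have [L [C [WC covC]]] := rT (fun m => W (k + m)%N) (fun=> oW _) (fun=> covW _).
exists (k + L)%N, (fun m => if (m < k)%N then B m else C (m - k)%N); split.
  move=> m mkL; case: ltnP => [mk|km].
    by apply: disjointly_refines_trans (OB m mk) => r; have [WO _ _ _] := SP m; exact: WO.
  by rewrite -{1}(subnKC km); apply: WC; lia.
move=> x _; have [n [nk Ax]] := covA x; have [cx|cx] := leqP (c n x) (j n).
  by exists n; rewrite nk ltn_addr.
have [|m [mL Cx]] := covC x.
  exists n; split=> //; have [+ _] := cP n nk x Ax.
  by rewrite /V leqNgt cx /= => /ltW.
by exists (k + m)%N; rewrite ltn_add2l [(k + m < k)%N]ltnNge leq_addr /= addKn.
Qed.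
End FiniteDimensional.

(** * Extension of maps from spheres to cubes *)

Section WithinContinuity.

Lemma within_continuousP (S T : topologicalType) (A : set S) (f : S -> T) :
  {within A, continuous f} <->
  forall x, A x -> forall P, nbhs (f x) P -> \forall y \near x, A y -> P (f y).
Proof.
split=> [/subspace_continuousP cf x Ax P nP|cf].
  exact: (cf x Ax P nP).
by apply/subspace_continuousP => x Ax P nP; exact: (cf x Ax P nP).
Qed.

Lemma within_continuous_sub (S T : topologicalType) (A B : set S) (f : S -> T) :
  A `<=` B -> {within B, continuous f} -> {within A, continuous f}.
Proof.
move=> AB /within_continuousP cf; apply/within_continuousP => x Ax P nP.
by apply: filterS (cf x (AB x Ax) P nP) => y + /AB; apply.
Qed.

Lemma within_continuous_eq (S T : topologicalType) (A : set S) (f g : S -> T) :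
  (forall x, A x -> f x = g x) -> {within A, continuous f} ->
  {within A, continuous g}.
Proof.
move=> fg /within_continuousP cf; apply/within_continuousP => x Ax P.
rewrite -(fg x Ax) => nP; apply: filterS (cf x Ax P nP) => y + Ay.
by rewrite -(fg y Ay); apply.
Qed.

Lemma within_continuous_compose (S T U : topologicalType) (A : set S) (B : set T)
    (f : S -> T) (g : T -> U) :
  (forall x, A x -> B (f x)) -> {within A, continuous f} ->
  {within B, continuous g} -> {within A, continuous (g \o f)}.
Proof.
move=> AB /within_continuousP cf /within_continuousP cg.
apply/within_continuousP => x Ax P nP.
have := cf x Ax _ (cg (f x) (AB x Ax) P nP).
by apply: filterS => y fy Ay; apply: fy => //; exact: AB.
Qed.

Lemma continuous_within (S T : topologicalType) (A : set S) (f : S -> T) :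
  (forall x, A x -> {for x, continuous f}) -> {within A, continuous f}.
Proof.
move=> cf; apply/within_continuousP => x Ax P nP.
have nPf : \forall y \near x, P (f y) := cf x Ax P nP.
by apply: filterS nPf => y Py _.
Qed.

Lemma within_continuous_seq (S T : topologicalType) (J : choiceType) (s : seq J)
    (C : J -> set S) (f : S -> T) : (forall j, j \in s -> closed (C j)) ->
  (forall j, j \in s -> {within C j, continuous f}) ->
  {within [set x | exists2 j, j \in s & C j x], continuous f}.
Proof.
move=> clC cf.
have eqC (r : seq J) : [set x | exists2 j, j \in r & C j x] =
    \big[setU/set0]_(j <- r) C j.
  rewrite -bigcup_seq eqEsubset.
  by split=> x [j jr Cx]; exists j.
rewrite eqC; elim: s clC cf => [|j s IH] clC cf.
  by rewrite big_nil; exact: continuous_subspace0.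
have jsP k : k \in s -> k \in j :: s by rewrite in_cons => ->; rewrite orbT.
rewrite big_cons; apply: withinU_continuous.
- by apply: clC; rewrite mem_head.
- by apply: closed_bigsetU => k /jsP; exact: clC.
- by apply: cf; rewrite mem_head.
- by apply: IH => k /jsP; [exact: clC | exact: cf].
Qed.
End WithinContinuity.

Lemma continuous_rV (S : topologicalType) n (f : S -> 'rV[RR]_n) :
  (forall j, continuous (fun x => f x ord0 j)) -> continuous f.
Proof.
move=> cf x P [Q lQ QP].
have : \forall y \near x, forall j, Q ord0 j (f y ord0 j).
  by apply: filter_forall => j; exact: (cf j x _ (lQ ord0 j)).
by apply: filterS => y Qy; apply: QP => i j; rewrite (ord1 i).
Qed.

Lemma continuous_ptws (S : topologicalType) (f : S -> {ptws nat -> RR}) :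
  (forall j, continuous (fun x => f x j)) -> continuous f.
Proof. by move=> cf x; apply/(@pointwise_cvgP nat RR) => j; exact: cf. Qed.

Lemma ptws_eval_continuous (j : nat) : continuous (fun t : {ptws nat -> RR} => t j).
Proof. by move=> t; exact: (@proj_continuous nat (fun=> RR) j t). Qed.

Section BallExtension.
Variable k : nat.
Let V := 'rV[RR]_k.+1.

Lemma ler_coord_norm (w : V) j : `|w ord0 j| <= `|w|.
Proof.
rewrite [leRHS](_ : _ = mx_norm w) // mx_normrE.
exact: (le_bigmax _ (fun ij => `|w ij.1 ij.2|) (ord0, j)).
Qed.

Lemma norm_coord_max (w : V) : w != 0 -> exists j, `|w| = `|w ord0 j|.
Proof.
move=> w0; have [|[i j] /= wij] := @mx_norm_neq0 _ _ _ w.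
  by apply: contra w0 => /eqP /mx_norm_eq0 ->.
by move: wij; rewrite (ord1 i) => wij; exists j.
Qed.

(** The norm of row vectors is the maximum norm, whose unit ball is a cube; radial projection
    identifies its boundary with the Euclidean sphere. *)
Definition sqnorm (w : V) : RR := \sum_(i < k.+1) (w ord0 i) ^+ 2.

Lemma sqnorm_continuous : continuous sqnorm.
Proof.
apply: (continuous_big add_continuous) => i _ w.
have cw := @coord_continuous RR 1 k.+1 ord0 i w.
exact: (cvgM cw cw).
Qed.

Lemma sqnorm_gt0 (w : V) : w != 0 -> 0 < sqnorm w.
Proof.
move=> w0; rewrite lt_def sumr_ge0 ?andbT => [|i _]; last exact: sqr_ge0.
apply: contra w0; rewrite psumr_eq0 => [/allP w0|i _]; last exact: sqr_ge0.
apply/eqP/rowP => i; rewrite mxE; have := w0 i (mem_index_enum _).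
by rewrite sqrf_eq0 => /eqP.
Qed.

Definition to_sphere (w : V) : V := (Num.sqrt (sqnorm w))^-1 *: w.

Lemma to_sphereP (w : V) : w != 0 -> sphere k (to_sphere w).
Proof.
move=> /sqnorm_gt0 w0; rewrite /sphere /=.
under eq_bigr do rewrite /to_sphere mxE exprMn.
rewrite -mulr_sumr exprVn sqr_sqrtr ?(ltW w0) // -/(sqnorm w) mulVf //.
exact: lt0r_neq0.
Qed.

Lemma to_sphere_continuous (w : V) : w != 0 -> {for w, continuous to_sphere}.
Proof.
move=> w0.
have c1 : (fun x : V => Num.sqrt (sqnorm x)) @ w --> Num.sqrt (sqnorm w).
  apply: (@continuous_comp _ _ _ sqnorm Num.sqrt); first exact: sqnorm_continuous.
  exact: sqrt_continuous.
have ne : Num.sqrt (sqnorm w) != 0 by rewrite sqrtr_eq0 -ltNge sqnorm_gt0.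
exact: (cvgZ (cvgV ne c1) (@cvg_id _ (nbhs w))).
Qed.

Definition to_cube (w : V) : V := `|w|^-1 *: w.

Lemma norm_to_cube (w : V) : w != 0 -> `|to_cube w| = 1.
Proof.
by move=> w0; rewrite normrZ normfV normr_id mulVf // normr_eq0.
Qed.

Lemma to_cube_continuous (w : V) : w != 0 -> {for w, continuous to_cube}.
Proof.
move=> w0.
have c1 : (fun x : V => `|x|) @ w --> `|w| by exact: norm_continuous.
have ne : `|w| != 0 by rewrite normr_eq0.
exact: (cvgZ (cvgV ne c1) (@cvg_id _ (nbhs w))).
Qed.

Lemma to_cube_to_sphere (w : V) : `|w| = 1 -> to_cube (to_sphere w) = w.
Proof.
move=> w1; have w0 : w != 0 by rewrite -normr_eq0 w1 oner_neq0.
have s0 : 0 < (Num.sqrt (sqnorm w))^-1 by rewrite invr_gt0 sqrtr_gt0 sqnorm_gt0.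
rewrite /to_cube /to_sphere normrZ w1 mulr1 scalerA gtr0_norm // mulVf ?scale1r //.
exact: lt0r_neq0.
Qed.

Lemma sphere_neq0 (w : V) : sphere k w -> w != 0.
Proof.
rewrite /sphere /= => w1; apply/eqP => w0; move: w1; rewrite w0.
under eq_bigr do rewrite mxE expr0n /=.
by rewrite big1 // => /esym/eqP; rewrite oner_eq0.
Qed.

(** The contraction of [g] in [B] is run along the radii, from norm 1 down to norm 1/2; inside, the
    map is constant. *)
Lemma ball_extension (Y : topologicalType) (A B : set Y) m (g : V -> Y) :
  (k <= m)%N -> Cm_embedded m A B ->
  {within [set w : V | `|w| = 1], continuous g} ->
  (forall w, `|w| = 1 -> A (g w)) ->
  exists G : V -> Y, [/\ {within [set w : V | `|w| <= 1], continuous G},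
    forall w, `|w| = 1 -> G w = g w & forall w, `|w| <= 1 -> B (G w)].
Proof.
move=> km AB cg gA.
have [||H [cH [HB [H0 [y0 H1]]]]] := AB k km (g \o to_cube).
- apply: within_continuous_compose cg.
    by move=> w /sphere_neq0; exact: norm_to_cube.
  by apply: continuous_within => w /sphere_neq0; exact: to_cube_continuous.
- by move=> _ [w /sphere_neq0 w0 <-]; apply/gA/norm_to_cube.
have half_gt0 (w : V) : 2^-1 <= `|w| -> w != 0.
  by rewrite -normr_gt0; lra.
pose phi (w : V) := (to_sphere w, 2 * (1 - `|w|)) : V * RR.
(* This vector yields a point of the sphere, which shows that [y0] lies in [B]. *)
have one0 : (const_mx 1 : V) != 0.
  apply/eqP => /matrixP /(_ ord0 ord0); rewrite !mxE => /eqP.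
  by rewrite oner_eq0.
exists (fun w => if `|w| <= 2^-1 then y0 else H (phi w)); split.
- have cnorm : continuous (fun w : V => `|w|) by exact: norm_continuous.
  have cl1 : closed [set w : V | `|w| <= 2^-1].
    by apply: (@preimage_closed _ _ (fun w : V => `|w|) [set t | t <= 2^-1]) => //;
      exact: closed_le.
  have cl2 : closed [set w : V | 2^-1 <= `|w| /\ `|w| <= 1].
    apply: closedI.
      by apply: (@preimage_closed _ _ (fun w : V => `|w|) [set t | 2^-1 <= t]) => //;
        exact: closed_ge.
    by apply: (@preimage_closed _ _ (fun w : V => `|w|) [set t | t <= 1]) => //;
      exact: closed_le.
  apply: (@within_continuous_sub _ _ _ ([set w : V | `|w| <= 2^-1] `|`
      [set w : V | 2^-1 <= `|w| /\ `|w| <= 1])).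
    by move=> w w1; have [w2|/ltW w2] := leP `|w| 2^-1; [left | right].
  apply: withinU_continuous => //.
    apply: (@within_continuous_eq _ _ _ (fun=> y0)) => [w /= ->//|].
    by apply: continuous_within => w _; exact: cst_continuous.
  apply: (@within_continuous_eq _ _ _ (H \o phi)) => [w [w2 w1] /=|].
    case: ifP => // w2'; have w_half : `|w| = 2^-1 by apply/eqP; rewrite eq_le w2 w2'.
    rewrite /phi w_half (_ : 2 * (1 - 2^-1) = 1); last by lra.
    by apply: H1; apply: to_sphereP; apply: half_gt0.
  apply: within_continuous_compose cH => [w [w2 w1]|].
    split; first by apply: to_sphereP; apply: half_gt0.
    by rewrite /= in_itv /=; apply/andP; split; lra.
  apply: continuous_within => w [/half_gt0 w0 _].
  have c1 : to_sphere @ w --> to_sphere w by exact: to_sphere_continuous.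
  have c2 : (fun w : V => 2 * (1 - `|w|)) @ w --> 2 * (1 - `|w|).
    exact: (cvgM (cvg_cst _) (cvgB (cvg_cst _) (cnorm w))).
  exact: (cvg_pair c1 c2).
- move=> w w1; rewrite w1 ifF; last by apply/negbTE; rewrite -ltNge; lra.
  have w0 : w != 0 by apply: half_gt0; rewrite w1; lra.
  rewrite /phi w1 subrr mulr0 H0 /=; last exact: to_sphereP.
  by rewrite to_cube_to_sphere.
- move=> w w1; case: ifP => [_|/negbT]; rewrite -?ltNge.
    rewrite -(H1 _ (to_sphereP one0)); apply: HB; first exact: to_sphereP.
    by rewrite /= in_itv /= ler01 lexx.
  move=> w2; apply: HB; first by apply/to_sphereP/half_gt0/ltW.
  by rewrite /= in_itv /=; apply/andP; split; lra.
Qed.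
End BallExtension.

Definition hcube : set {ptws nat -> RR} := [set t | forall i, 0 <= t i <= 1].

Lemma compact_hcube : compact hcube.
Proof.
have -> : hcube = [set t : forall i : nat, RR | forall i, `[0, 1]%classic (t i)].
  by rewrite eqEsubset; split=> t ct i; have := ct i; rewrite /= in_itv.
by apply: (@tychonoff nat (fun=> RR) (fun=> `[0, 1]%classic)) => _; apply: segment_compact.
Qed.

Definition restrict (s : seq nat) (t : {ptws nat -> RR}) : {ptws nat -> RR} :=
  fun i => if i \in s then t i else 0.

Lemma restrict_hcube s t : hcube t -> hcube (restrict s t).
Proof. by move=> ct i; rewrite /restrict; case: ifP => // _; rewrite lexx ler01. Qed.

Definition cube_boundary (s : seq nat) : set {ptws nat -> RR} :=
  [set t | [/\ hcube t, forall i, i \notin s -> t i = 0 &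
    exists2 i, i \in s & t i = 0 \/ t i = 1]].

(** The coordinates in [s], rescaled from [0, 1] to [-1, 1], identify the cube over [s] with the
    unit ball of the maximum norm; the extension ignores all other coordinates. *)
Lemma cube_extension (Y : topologicalType) (A B : set Y) m (s : seq nat)
    (b : {ptws nat -> RR} -> Y) :
  uniq s -> (0 < size s <= m.+1)%N -> Cm_embedded m A B ->
  {within cube_boundary s, continuous b} ->
  (forall t, cube_boundary s t -> A (b t)) ->
  exists G : {ptws nat -> RR} -> Y, [/\ {within hcube, continuous G},
    forall t, hcube t -> B (G t),
    forall t, hcube t -> cube_boundary s (restrict s t) -> G t = b (restrict s t) &
    forall t t', (forall i, i \in s -> t i = t' i) -> G t = G t'].
Proof.
move=> us /andP[s0 sm] AB cb bA.
have [k sk] : exists k, size s = k.+1 by case: (size s) s0 => // k; exists k.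
have km : (k <= m)%N by rewrite sk in sm.
pose emb (w : 'rV[RR]_k.+1) : {ptws nat -> RR} :=
  fun i => if i \in s then (1 + w ord0 (inord (index i s))) / 2 else 0.
pose prj (t : {ptws nat -> RR}) : 'rV[RR]_k.+1 := \row_j (2 * t (nth 0%N s j) - 1).
have emb_prj t : emb (prj t) = restrict s t.
  apply/funext => i; rewrite /emb /restrict; case: ifP => // si.
  rewrite !mxE inordK ?nth_index -?sk ?index_mem //; lra.
have nth_s (j : 'I_k.+1) : nth 0%N s j \in s by rewrite mem_nth // sk.
have emb_nth w (j : 'I_k.+1) : emb w (nth 0%N s j) = (1 + w ord0 j) / 2.
  by rewrite /emb nth_s index_uniq ?sk // inord_val.
have emb_bdry w : `|w| = 1 -> cube_boundary s (emb w).
  move=> w1; split.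
  - move=> i; rewrite /emb; case: ifP => _; last by rewrite lexx ler01.
    have := ler_coord_norm w (inord (index i s)); rewrite w1 ler_norml => /andP[? ?].
    by apply/andP; split; lra.
  - by move=> i /negPf si; rewrite /emb si.
  have w0 : w != 0 by rewrite -normr_eq0 w1 oner_neq0.
  have [j wj] := norm_coord_max w0; exists (nth 0%N s j) => //.
  rewrite emb_nth; have [w_ge|w_lt] := leP 0 (w ord0 j).
    by right; rewrite ger0_norm // in wj; lra.
  by left; rewrite ltr0_norm // in wj; lra.
have prj_le t : hcube t -> `|prj t| <= 1.
  move=> ct; have [->|/norm_coord_max[j ->]] := eqVneq (prj t) 0.
    by rewrite normr0 ler01.
  rewrite mxE ler_norml; have /andP[? ?] := ct (nth 0%N s j).
  by apply/andP; split; lra.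
have prj_bdry t : hcube t -> cube_boundary s (restrict s t) -> `|prj t| = 1.
  move=> ct [_ _ [i si ti]]; apply/eqP; rewrite eq_le prj_le //=.
  have := ler_coord_norm (prj t) (inord (index i s)); apply: le_trans.
  rewrite mxE inordK ?nth_index -?sk ?index_mem //.
  move: ti; rewrite /restrict si => -[->|->].
    by rewrite mulr0 sub0r normrN normr1.
  by rewrite (_ : 2 * 1 - 1 = 1) ?normr1 //; lra.
have emb_cont : continuous emb.
  apply: continuous_ptws => i w; rewrite /emb /continuous_at.
  case: (i \in s); last exact: (@cst_continuous _ _ (0 : RR)).

  have c1 := @coord_continuous RR 1 k.+1 ord0 (inord (index i s)) w.
  exact: (cvgM (cvgD (cvg_cst _) c1) (cvg_cst _)).
have prj_cont : continuous prj.
  apply: continuous_rV => j t; rewrite /continuous_at mxE.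
  under eq_cvg do rewrite mxE.
  have c1 := @ptws_eval_continuous (nth 0%N s j) t.
  exact: (cvgB (cvgM (cvg_cst _) c1) (cvg_cst _)).
have [||G0 [cG0 G0b G0B]] := @ball_extension k Y A B m (b \o emb) km AB.
- apply: within_continuous_compose cb; first exact: emb_bdry.
  by apply: continuous_within => w _; exact: emb_cont.
- by move=> w w1; exact/bA/emb_bdry.
exists (G0 \o prj); split.
- apply: within_continuous_compose cG0; first exact: prj_le.
  by apply: continuous_within => t _; exact: prj_cont.
- by move=> t ct; exact/G0B/prj_le.
- by move=> t ct bt; rewrite /= G0b /= ?emb_prj //; exact: prj_bdry.
- move=> t t' tt'; rewrite /=; congr G0; apply/rowP => j.
  by rewrite !mxE tt'.
Qed.

(** * Extension to cones *)

Section Cone.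
Variable I : choiceType.

(* A partial choice of vertices, at most one per level; it spans the simplices
   of the join of countably many copies of the discrete space I. *)
Definition drop_vertex (v : nat -> option I) (i : nat) : nat -> option I :=
  fun j => if j == i then None else v j.

Definition levels (n : nat) (v : nat -> option I) : seq nat :=
  [seq i <- iota 0 n | isSome (v i)].

(* Points of a simplex are parametrized by coordinates in [0, 1] of maximum 1;
   the coordinates of its cone are arbitrary. *)
Definition on_top (v : nat -> option I) (t : {ptws nat -> RR}) : Prop :=
  exists i, isSome (v i) /\ t i = 1.

Lemma drop_vertexC v i j :
  drop_vertex (drop_vertex v i) j = drop_vertex (drop_vertex v j) i.
Proof. by apply/funext => k; rewrite /drop_vertex; case: eqP => // _; case: eqP. Qed.

Lemma drop_vertex_id v i : v i = None -> drop_vertex v i = v.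
Proof. by move=> vi; apply/funext => k; rewrite /drop_vertex; case: eqP => // ->. Qed.

Lemma size_levels_drop n v i : (i < n)%N -> isSome (v i) ->
  (size (levels n (drop_vertex v i))).+1 = size (levels n v).
Proof.
move=> ni vi; have -> : levels n (drop_vertex v i) = rem i (levels n v).
  rewrite rem_filter ?filter_uniq ?iota_uniq // -filter_predI.
  apply: eq_filter => j; rewrite /= /drop_vertex.
  by case: eqP.
rewrite size_rem ?mem_filter ?vi ?mem_iota ?ni // prednK //.
rewrite lt0n size_eq0; apply/eqP => s0.
have := mem_filter (fun i => isSome (v i)) i (iota 0 n).
by rewrite -/(levels n v) s0 vi mem_iota ni.
Qed.

Lemma on_top_drop v t i : on_top v t -> t i = 0 -> on_top (drop_vertex v i) t.
Proof.
move=> [j [vj tj]] ti; exists j; split=> //; rewrite /drop_vertex.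
by case: eqP => // ji; move: tj; rewrite ji ti => /eqP; rewrite eq_sym oner_eq0.
Qed.

Lemma closed_hcube_eq (i : nat) (c : RR) : closed (hcube `&` [set t | t i = c]).
Proof.
apply: closedI.
  by apply: compact_closed compact_hcube; apply: hausdorff_product => _; exact: Rhausdorff.
apply: (@preimage_closed _ _ (fun t : {ptws nat -> RR} => t i) [set c]).
  by move=> t _; exact: ptws_eval_continuous.
exact: closed_eq.
Qed.

Lemma closed_on_top n v : (forall i, (n <= i)%N -> v i = None) ->
  closed (hcube `&` on_top v).
Proof.
move=> vn; have -> : hcube `&` on_top v =
    \big[setU/set0]_(i <- levels n v) (hcube `&` [set t : {ptws nat -> RR} | t i = 1]).
  rewrite -bigcup_seq eqEsubset; split=> t.
    move=> [ct [i [vi ti]]]; exists i => //=; rewrite mem_filter vi mem_iota /=.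
    by rewrite ltnNge; apply/negP => /vn vi0; rewrite vi0 in vi.
  move=> [i /=]; rewrite mem_filter => /andP[vi _] [ct ti].
  by split=> //; exists i.
by apply: closed_bigsetU => i _; exact: closed_hcube_eq.
Qed.

Variables (Y : topologicalType) (n : nat) (adm : (nat -> option I) -> Prop).
Variable f : (nat -> option I) -> {ptws nat -> RR} -> Y.
Variable A : nat -> set Y.
Hypothesis adm_drop : forall v i, adm v -> adm (drop_vertex v i).
Hypothesis adm_fin : forall v i, adm v -> (n <= i)%N -> v i = None.
Hypothesis A_nonempty : A 0%N !=set0.
Hypothesis A_sub : forall m, A m `<=` A m.+1.
Hypothesis A_emb : forall m, Cm_embedded m (A m) (A m.+1).
Hypothesis f_cont : forall v, adm v -> {within hcube `&` on_top v, continuous (f v)}.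
Hypothesis f_drop : forall v t i, adm v -> hcube t -> on_top v t -> t i = 0 ->
  f v t = f (drop_vertex v i) t.
Hypothesis f_A : forall v t, adm v -> hcube t -> on_top v t -> A 0%N (f v t).
Hypothesis f_dep : forall v t t', adm v -> on_top v t ->
  (forall i, isSome (v i) -> t i = t' i) -> f v t = f v t'.

Let A_mono m p : (m <= p)%N -> A m `<=` A p.
Proof.
elim: p => [|p IH]; first by rewrite leqn0 => /eqP ->.
rewrite leq_eqVlt => /orP[/eqP -> //|/IH mp].
exact: subset_trans mp (@A_sub p).
Qed.

(** The cube over [v] is the cone of the simplex [v]: its apex is 0, its base is where some
    coordinate is 1, and its faces [t i = 0] are the cones of the facets. *)
Record cone_map (r : nat) (E : (nat -> option I) -> {ptws nat -> RR} -> Y)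
    (v : nat -> option I) : Prop := ConeMap {
  cone_cont : {within hcube, continuous (E v)};
  cone_drop : forall t i, hcube t -> t i = 0 -> E v t = E (drop_vertex v i) t;
  cone_A : forall t, hcube t -> A r (E v t);
  cone_dep : forall t t', (forall i, isSome (v i) -> t i = t' i) -> E v t = E v t';
  cone_top : forall t, hcube t -> on_top v t -> E v t = f v t }.

Let level_in v i : adm v -> isSome (v i) -> (i < n)%N.
Proof. by move=> av vi; rewrite ltnNge; apply/negP => /(adm_fin av) vi0; rewrite vi0 in vi. Qed.

Let mem_levels v i : adm v -> (i \in levels n v) = isSome (v i).
Proof.
move=> av; rewrite mem_filter mem_iota /=; case vi: (v i) => [x|] //=.
by rewrite (@level_in v) ?vi.
Qed.

(** On the boundary of the cube over [v], an [r]-sphere, the map is given by [f] on the base and by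
    [E] on the cones of the facets; [cube_extension] fills the cube. *)
Lemma cone_step r E v : (forall u, adm u -> (size (levels n u) <= r)%N -> cone_map r E u) ->
  adm v -> size (levels n v) = r.+1 ->
  exists G : {ptws nat -> RR} -> Y, [/\ {within hcube, continuous G},
    forall t i, hcube t -> isSome (v i) -> t i = 0 -> G t = E (drop_vertex v i) t,
    forall t, hcube t -> A r.+1 (G t),
    forall t t', (forall i, isSome (v i) -> t i = t' i) -> G t = G t' &
    forall t, hcube t -> on_top v t -> G t = f v t].
Proof.
move=> cE av sv; pose s := levels n v.
have us : uniq s by rewrite filter_uniq ?iota_uniq.
have cEd i : isSome (v i) -> cone_map r E (drop_vertex v i).
  move=> vi; apply: cE; first exact: adm_drop.
  by rewrite -ltnS (size_levels_drop (level_in av vi) vi) sv.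
have /choice[z zP] : forall t : {ptws nat -> RR}, exists i,
    (exists2 j, isSome (v j) & t j = 0) -> isSome (v i) /\ t i = 0.
  move=> t; have [[i vi ti]|nt] := pselect (exists2 j, isSome (v j) & t j = 0).
    by exists i.
  by exists 0%N.
(* Compatibility of [E] with faces makes the value independent of the zero coordinate [z t] that was
   picked. *)
pose b t := if pselect (on_top v t) then f v t else E (drop_vertex v (z t)) t.
have b_top t : on_top v t -> b t = f v t by rewrite /b; case: pselect.
have b_zero t i : hcube t -> isSome (v i) -> t i = 0 -> b t = E (drop_vertex v i) t.
  move=> ct vi ti; rewrite /b; case: pselect => [tt|ntt].
    by rewrite (f_drop av ct tt ti) (cone_top (cEd i vi)) //; exact: on_top_drop.
  have [vz tz] : isSome (v (z t)) /\ t (z t) = 0 by apply: zP; exists i.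
  rewrite (cone_drop (cEd _ vz) ct ti) (cone_drop (cEd _ vi) ct tz).
  by rewrite drop_vertexC.
have bdryE t : cube_boundary s t ->
    on_top v t \/ exists2 i, i \in s & t i = 0.
  move=> [_ _ [i si [ti|ti]]]; first by right; exists i.
  by left; exists i; rewrite -mem_levels.
have b_cont : {within cube_boundary s, continuous b}.
  apply: (@within_continuous_sub _ _ _ ((hcube `&` on_top v) `|`
     [set t | exists2 i, i \in s & (hcube `&` [set t : {ptws nat -> RR} | t i = 0]) t])).
    move=> t bt; have [ct _ _] := bt; have [tt|[i si ti]] := bdryE t bt.
      by left.
    by right; exists i.
  have clU (r' : seq nat) : closed [set t | exists2 i, i \in r' &
      (hcube `&` [set t : {ptws nat -> RR} | t i = 0]) t].
    have -> : [set t | exists2 i, i \in r' &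
      (hcube `&` [set t : {ptws nat -> RR} | t i = 0]) t] =
      \big[setU/set0]_(i <- r') (hcube `&` [set t : {ptws nat -> RR} | t i = 0]).
      by rewrite -bigcup_seq eqEsubset; split=> t [i si ct]; exists i.
    by apply: closed_bigsetU => i _; exact: closed_hcube_eq.
  apply: withinU_continuous => //.
  - by apply: (@closed_on_top n) => i; exact: adm_fin.
  - apply: within_continuous_eq (f_cont av) => t [_ tt]; exact/esym/b_top.
  apply: within_continuous_seq => i; first by move=> _; exact: closed_hcube_eq.
  rewrite mem_levels // => vi.
  apply: (@within_continuous_eq _ _ _ (E (drop_vertex v i))) => [t [ct ti]|].
    exact/esym/b_zero.
  by apply: within_continuous_sub (cone_cont (cEd i vi)) => t [].
have b_A t : cube_boundary s t -> A r (b t).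
  move=> bt; have [ct _ _] := bt; have [tt|[i si ti]] := bdryE t bt.
    by rewrite b_top //; apply: (A_mono (leq0n r)); exact: f_A.
  by rewrite mem_levels // in si; rewrite (b_zero t i) //; exact: (cone_A (cEd i si)).
have s1 : (0 < size s <= r.+1)%N by rewrite sv leqnn.
have [G [cG GA Gb Gdep]] := cube_extension us s1 (@A_emb r) b_cont b_A.
have res_bdry t : hcube t -> on_top v t \/ (exists2 i, isSome (v i) & t i = 0) ->
    cube_boundary s (restrict s t).
  move=> ct tt; split.
  - exact: restrict_hcube.
  - by move=> i /negPf si; rewrite /restrict si.
  by case: tt => [[i [vi ti]]|[i vi ti]]; exists i; rewrite ?mem_levels // /restrict
     mem_levels // vi; [right|left].
exists G; split=> //.
- move=> t i ct vi ti; have bt := res_bdry t ct (or_intror (ex_intro2 _ _ i vi ti)).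
  rewrite Gb // (b_zero _ i) //; last by rewrite /restrict ti; case: ifP.
    apply: (cone_dep (cEd i vi)) => j; rewrite /restrict mem_levels // /drop_vertex.
    by case: eqP => // _ ->.
  exact: restrict_hcube.
- move=> t t' tt'; apply: Gdep => i; rewrite mem_levels //; exact: tt'.
- move=> t ct tt; rewrite Gb //; last by apply: res_bdry => //; left.
  have tr : on_top v (restrict s t).
    by case: tt => i [vi ti]; exists i; rewrite /restrict mem_levels // vi.
  rewrite b_top //; apply: f_dep => // i vi.
  by rewrite /restrict mem_levels // vi.
Qed.

(* Induction on the number of vertices: each further vertex costs one step in
   the chain A. *)
Lemma cone_exists : exists E, forall v, adm v -> cone_map n E v.
Proof.
suff [E EP] : exists E, forall v, adm v -> (size (levels n v) <= n)%N -> cone_map n E v.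
  exists E => v av; apply: EP => //.
  by rewrite size_filter (leq_trans (count_size _ _)) // size_iota.
(* The induction is on the number of vertices allowed, which is also the stage reached in [A]; the
   [n] in [levels] stays fixed. *)
elim: {2 3}n => [|r [E EP]].
  have [y0 Ay0] := A_nonempty; exists (fun _ _ => y0) => v av.
  rewrite leqn0 size_eq0 => /eqP v0.
  have nv i : isSome (v i) = false by rewrite -mem_levels // v0.
  split=> //; first by apply: continuous_within => t _; exact: cst_continuous.
  by move=> t _ [i [vi _]]; rewrite nv in vi.
have /choice[G GP] : forall v, exists G : {ptws nat -> RR} -> Y,
  adm v -> size (levels n v) = r.+1 ->
  [/\ {within hcube, continuous G},
    forall t i, hcube t -> isSome (v i) -> t i = 0 -> G t = E (drop_vertex v i) t,
    forall t, hcube t -> A r.+1 (G t),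
    forall t t', (forall i, isSome (v i) -> t i = t' i) -> G t = G t' &
    forall t, hcube t -> on_top v t -> G t = f v t].
  move=> v; have [[av sv]|nv] := pselect (adm v /\ size (levels n v) = r.+1).
    by have [G GP] := cone_step EP av sv; exists G.
  by exists (E v) => av sv; case: nv.
exists (fun v => if (size (levels n v) <= r)%N then E v else G v) => v av.
have le_drop i : (size (levels n v) <= r.+1)%N -> isSome (v i) ->
    (size (levels n (drop_vertex v i)) <= r)%N.
  by move=> svr vi; rewrite -ltnS (size_levels_drop (level_in av vi) vi).
rewrite leq_eqVlt => /orP[/eqP sv|].
  have [cG G0 GA Gd Gt] := GP v av sv.
  have nsv : (size (levels n v) <= r)%N = false by rewrite sv ltnn.
  split; rewrite ?nsv //.
  move=> t i ct ti; case vi : (v i) => [x|]; last by rewrite drop_vertex_id // nsv.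
  by rewrite le_drop ?vi ?sv //; apply: G0 => //; rewrite vi.
rewrite ltnS => svr; have [cE Ed EA Edep Et] := EP v av svr.
split; rewrite ?svr //.
- move=> t i ct ti; case vi : (v i) => [x|]; last by rewrite drop_vertex_id // svr.
  by rewrite le_drop ?vi //; [exact: Ed | exact: leqW].
- by move=> t ct; apply/A_sub/EA.
Qed.
End Cone.

(** * The tower of covers and the selection *)

Lemma Cm_embeddedS (Y : topologicalType) m p (A B : set Y) :
  (m <= p)%N -> Cm_embedded p A B -> Cm_embedded m A B.
Proof. by move=> mp AB k km; apply: AB; exact: leq_trans mp. Qed.

Lemma locally_finite_closure (X : topologicalType) (I : choiceType)
    (O : I -> set X) : locally_finite_indexed O ->
  locally_finite_indexed (fun i => closure (O i)).
Proof.
move=> lf x; have [N Nx finN] := lf x.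
exists N°; first exact: nbhs_interior.
apply: sub_finite_set finN => i [y [clOy Ny]].
by have [z [Oz Nz]] := clOy _ Ny; exists z.
Qed.

Section Tower.
Variables (X Y : topologicalType) (pX : paracompact X).
Variable phi : nat -> X -> set Y.
Hypothesis phi_ne : forall n, nonempty_valued (phi n).
Hypothesis phi_lsc : forall n, strongly_lsc (phi n).
Hypothesis phi_asph : aspherical phi.

(* Extending over the cone of a simplex with n vertices costs n terms of phi. *)
Fixpoint stage (n : nat) : nat := if n is n'.+1 then stage n' + n' else 0.

Definition admissible (n : nat) (C : nat -> X -> set X) (x : X)
    (v : nat -> option X) :=
  forall i z, v i = Some z -> (i < n)%N /\ C i z x.

Lemma admissible_drop n C x v i :
  admissible n C x v -> admissible n C x (drop_vertex v i).
Proof. by move=> av j z; rewrite /drop_vertex; case: eqP => // _; exact: av. Qed.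

Lemma admissible_fin n C x v i : admissible n C x v -> (n <= i)%N -> v i = None.
Proof.
move=> av ni; case vi: (v i) => [z|] //; have [] := av _ _ vi.
by rewrite ltnNge ni.
Qed.

Lemma finite_admissible n C x : (forall i, (i < n)%N -> locally_finite_indexed (C i)) ->
  finite_set [set v | admissible n C x v].
Proof.
elim: n => [|n IH] lfC.
  apply: (@sub_finite_set _ _ [set fun=> None]); last exact: finite_set1.
  by move=> v av /=; apply/funext => i; apply: (admissible_fin av).
have finS : finite_set [set z | C n z x].
  have [N Nx finN] := lfC n (ltnSn n) x; apply: sub_finite_set finN => z Cz.
  by exists x; split=> //; exact: nbhs_singleton.
have finO : finite_set (None |` (Some @` [set z | C n z x])).
  by rewrite finite_setU; split; [exact: finite_set1 | exact: finite_image].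
have finV := IH (fun i ni => lfC i (ltnW ni)).
apply: sub_finite_set (finite_image (fun p => fun i => if i == n then p.1 else p.2 i)
   (finite_setX finO finV)) => v av.
exists (v n, drop_vertex v n); last first.
  by apply/funext => i /=; rewrite /drop_vertex; case: eqP => // ->.
split=> /=.
  by case vn: (v n) => [z|]; [right; exists z => //; have [] := av _ _ vn | left].
move=> i z; rewrite /drop_vertex; case: eqP => // ni vi; have [] := av _ _ vi.
by rewrite ltnS leq_eqVlt => /orP[/eqP|].
Qed.

(* S.1 consists of covers by closed sets, indexed by X, and S.2 maps the join of
   the first n index sets into Y; the image of a simplex lies in phi (stage n) x
   as soon as x belongs to the members labelled by its vertices. *)
Record tower (n : nat) (S : (nat -> X -> set X) *
    ((nat -> option X) -> {ptws nat -> RR} -> Y)) : Prop := Tower {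
  tower_closed : forall i z, (i < n)%N -> closed (S.1 i z);
  tower_lf : forall i, (i < n)%N -> locally_finite_indexed (S.1 i);
  tower_cont : forall x v, admissible n S.1 x v ->
    {within hcube `&` on_top v, continuous (S.2 v)};
  tower_drop : forall x v t i, admissible n S.1 x v -> hcube t -> on_top v t ->
    t i = 0 -> S.2 v t = S.2 (drop_vertex v i) t;
  tower_phi : forall x v t, admissible n S.1 x v -> hcube t -> on_top v t ->
    phi (stage n) x (S.2 v t);
  tower_dep : forall x v t t', admissible n S.1 x v -> on_top v t ->
    (forall i, isSome (v i) -> t i = t' i) -> S.2 v t = S.2 v t' }.

Lemma phi_mono m p x : (m <= p)%N -> phi m x `<=` phi p x.
Proof.
elim: p => [|p IH]; first by rewrite leqn0 => /eqP ->.
rewrite leq_eqVlt => /orP[/eqP -> //|/IH mp].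
by apply: subset_trans mp _; have [] := phi_asph x p.
Qed.

(** The new vertices are points [z] of [X], each with its own extension [E z] to cones; the new
    member labelled [z] consists of points at which the images of these cones are still allowed. *)
Lemma tower_step n S : tower n S -> exists S', [/\ tower n.+1 S',
  forall i, (i < n)%N -> S'.1 i = S.1 i &
  forall x, exists z, (S'.1 n z)° x].
Proof.
case: S => [C f] [/= clC lfC fc fd fp fdep].
have /choice[E EP] : forall x, exists E, forall v, admissible n C x v ->
    cone_map f (fun m => phi (stage n + m)%N x) n E v.
  move=> x; apply: cone_exists.
  - by move=> v i; exact: admissible_drop.
  - by move=> v i; exact: admissible_fin.
  - exact: phi_ne.
  - by move=> m; rewrite addnS; have [] := phi_asph x (stage n + m)%N.
  - move=> m; rewrite addnS; have [_] := phi_asph x (stage n + m)%N.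
    by apply: Cm_embeddedS; exact: leq_addl.
  - exact: fc.
  - exact: fd.
  - by move=> v t av ct tt; rewrite addn0; exact: (fp x).
  - exact: fdep.
(* By the second condition, a simplex admissible at [y] is admissible at [x], so that [E x] controls
   its cone. *)
pose W x := [set y | (forall v, admissible n C x v ->
    E x v @` hcube `<=` phi (stage n.+1) y) /\
  forall i, (i < n)%N -> forall z, ~ C i z x -> ~ C i z y].
have oW x : open (W x).
  apply: open_from_near => y [Wy1 Wy2].
  have n1 : \forall y' \near y, forall v, admissible n C x v ->
      E x v @` hcube `<=` phi (stage n.+1) y'.
    apply: near_finite_forall; first exact: finite_admissible.
    move=> v av; apply: (near_open (phi_lsc _ _)); last exact: Wy1.
    by apply: continuous_compact compact_hcube; exact: (cone_cont (EP x v av)).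
  have n2 : \forall y' \near y, forall i, (i < n)%N ->
      forall z, ~ C i z x -> ~ C i z y'.
    apply: (@near_finite_forall _ _ _ `I_n); first exact: finite_II.
    move=> i ni; apply: (locally_finite_near (lfC i ni)) => [z y' //|z].
    have [Czx|nCzx] := pselect (C i z x); first by apply: nearW.
    have oC : open (~` C i z) by rewrite openC; exact: clC.
    by apply: filterS (near_open oC (Wy2 i ni z nCzx)).
  by move: n1 n2; apply: filterS2 => y' ? ?; split.
have Wx x : W x x.
  split=> // v av _ [t ct <-]; exact: (cone_A (EP x v av)).
have covW x : exists z, W z x by exists x.
have [ O [oO covO lfO OW]] := paracompact_shrink pX oW covW.
pose C' i := if i == n then (fun z => closure (O z)) else C i.
(* Where [t n = 1] the other coordinates run over a cone, mapped by [E z]; elsewhere [t n] is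
   ignored and [f] is used. The two agree on the overlap since [E z] extends [f]. *)
pose f' v t := if v n is Some z then
  if t n == 1 then E z (drop_vertex v n) t else f (drop_vertex v n) t
  else f (drop_vertex v n) t.
have C'n z : C' n z = closure (O z) by rewrite /C' eqxx.
have C'i i : (i < n)%N -> C' i = C i by rewrite /C'; case: eqP => // ->; rewrite ltnn.
have adm_n x v : admissible n.+1 C' x v -> admissible n C x (drop_vertex v n).
  move=> av i z; rewrite /drop_vertex; case: eqP => // ni /av[+ +].
  by rewrite ltnS leq_eqVlt => /orP[/eqP//|in']; rewrite C'i.
have adm_z x v z : admissible n.+1 C' x v -> v n = Some z ->
    W z x /\ admissible n C z (drop_vertex v n).
  move=> av vn; have [_] := av _ _ vn; rewrite C'n => /OW Wzx; split=> //.
  move=> i w /(adm_n _ _ av)[ni Cx]; split=> //; apply: contrapT => nCz.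
  by have [_ /(_ i ni w nCz)] := Wzx.
have f'_top x v t z : admissible n.+1 C' x v -> hcube t -> v n = Some z -> t n = 1 ->
    f' v t = E z (drop_vertex v n) t by rewrite /f' => _ _ -> ->; rewrite eqxx.
have f'_low x v t : admissible n.+1 C' x v -> hcube t ->
    on_top (drop_vertex v n) t -> f' v t = f (drop_vertex v n) t.
  move=> av ct tt; rewrite /f'; case vn: (v n) => [z|] //; case: eqP => // _.
  have [_ az] := adm_z _ _ _ av vn.
  exact: (cone_top (EP z _ az)).
have top_cases (v : nat -> option X) t : on_top v t ->
    (exists2 z, v n = Some z & t n = 1) \/ on_top (drop_vertex v n) t.
  move=> [i [vi ti]]; have [ni|ni] := eqVneq i n.
    left; move: vi ti; rewrite ni; case: (v n) => // z _ tn; by exists z.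
  by right; exists i; rewrite /drop_vertex (negPf ni).
exists (C', f'); split; last first.
- move=> x; have [z Oz] := covO x; exists z => /=; rewrite C'n.
  by apply: filterS (near_open (oO z) Oz) => y; exact: subset_closure.
- exact: C'i.
split=> /=.
- move=> i z; rewrite ltnS leq_eqVlt => /orP[/eqP ->|ni].
    by rewrite C'n; exact: closed_closure.
  by rewrite C'i //; exact: clC.
- move=> i; rewrite ltnS leq_eqVlt => /orP[/eqP ->|ni].
    by rewrite /C' eqxx; exact: locally_finite_closure.
  by rewrite C'i //; exact: lfC.
- move=> x v av; have an := adm_n _ _ av.
  have cl := closed_on_top (fun i => @admissible_fin _ _ _ _ i an).
  case vn: (v n) => [z|].
    have [_ az] := adm_z _ _ _ av vn.
    apply: (@within_continuous_sub _ _ _ ((hcube `&` [set t : {ptws nat -> RR} | t n = 1])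
        `|` (hcube `&` on_top (drop_vertex v n)))).
      by move=> t [ct /top_cases[[_ _ tn]|tt]]; [left | right].
    apply: withinU_continuous => //; first exact: closed_hcube_eq.
      apply: (@within_continuous_eq _ _ _ (E z (drop_vertex v n))) => [t [ct tn]|].
        by rewrite (f'_top x v t z).
      by apply: within_continuous_sub (cone_cont (EP z _ az)) => t [].
    apply: within_continuous_eq (fc x _ an) => t [ct tt].
    by rewrite (f'_low x).
  apply: (@within_continuous_eq _ _ _ (f v)) => [t [ct tt]|].
    by rewrite /f' vn drop_vertex_id.
  by have := fc x _ an; rewrite drop_vertex_id.
- move=> x v t i av ct tt ti; have an := adm_n _ _ av.
  have ad := @admissible_drop _ _ _ _ i av; have td := on_top_drop tt ti.
  have [[z vn tn]|tlow] := top_cases v t tt.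
    have ni : i != n by apply/eqP => ni; move: ti; rewrite ni tn => /eqP; rewrite oner_eq0.
    have [_ az] := adm_z _ _ _ av vn.
    rewrite (f'_top x v t z) // (f'_top x (drop_vertex v i) t z) //; last first.
      by rewrite /drop_vertex eq_sym (negPf ni).
    by rewrite (cone_drop (EP z _ az) ct ti) drop_vertexC.
  rewrite (f'_low x) // (f'_low x) //; last first.
    by rewrite drop_vertexC; apply: on_top_drop.
  by rewrite (fd x _ _ i an) // drop_vertexC.
- move=> x v t av ct tt; have an := adm_n _ _ av.
  have [[z vn tn]|tlow] := top_cases v t tt.
    have [[Wzx _] az] := adm_z _ _ _ av vn.
    by rewrite (f'_top x v t z) //; apply: (Wzx _ az); exists t.
  rewrite (f'_low x) //; apply: (phi_mono (leq_addr n (stage n))).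
  exact: (fp x).
- move=> x v t t' av tt tt'; have an := adm_n _ _ av.
  have dtt' i : isSome (drop_vertex v n i) -> t i = t' i.
    by rewrite /drop_vertex; case: eqP => // _; exact: tt'.
  rewrite /f'; case vn: (v n) => [z|].
    have [_ az] := adm_z _ _ _ av vn.
    rewrite -(tt' n) ?vn //; case: eqP => tn; first exact: (cone_dep (EP z _ az)).
    apply: (fdep x) => //; have [[z' _ tn']|//] := top_cases v t tt.
    by case: tn.
  apply: (fdep x) => //; have [[z']|//] := top_cases v t tt.
  by rewrite vn.
Qed.
End Tower.

(** * From the tower to a selection *)

Section Selection.
Variables (X Y : topologicalType) (pX : paracompact X).
Variable phi : nat -> X -> set Y.
Hypothesis phi_ne : forall n, nonempty_valued (phi n).
Hypothesis phi_lsc : forall n, strongly_lsc (phi n).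
Hypothesis phi_asph : aspherical phi.

Lemma admissible0 C (x : X) v t : admissible 0 C x v -> ~ on_top v t.
Proof.
by move=> av [i [vi _]]; case E: (v i) vi => [z|] // _; have [] := av _ _ E.
Qed.

Lemma tower0 C (y0 : Y) : tower phi 0 (C, fun _ _ => y0).
Proof.
split=> //=.
- move=> x v av; apply/within_continuousP => t [_ tt].
  by case: (admissible0 av tt).
- by move=> x v t av _ /(admissible0 av).
Qed.

(** Each step keeps the earlier covers, so the diagonal sequence of covers fits every stage. *)
Lemma tower_sequence : X -> exists (C : nat -> X -> set X)
    (f : nat -> (nat -> option X) -> {ptws nat -> RR} -> Y),
  (forall n, tower phi n (C, f n)) /\
  forall n x, exists z, (C n z)° x.
Proof.
move=> x0; have [y0 _] := @phi_ne 0 x0.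
pose St := ((nat -> X -> set X) * ((nat -> option X) -> {ptws nat -> RR} -> Y))%type.
have /choice[next nextP] : forall p : nat * St, exists S' : St, tower phi p.1 p.2 ->
    [/\ tower phi p.1.+1 S', forall i, (i < p.1)%N -> S'.1 i = p.2.1 i &
    forall x, exists z, (S'.1 p.1 z)° x].
  move=> [n S]; have [tS|ntS] := pselect (tower phi n S); last by exists S.
  by have [S' S'P] := tower_step pX phi_ne phi_lsc phi_asph tS; exists S'.
pose Sq := fix Sq n : St := if n is n'.+1 then next (n', Sq n') else
  ((fun _ _ => setT), fun _ _ => y0).
have SqT n : tower phi n (Sq n).
  elim: n => [|n IH]; first exact: tower0.
  by have [] := nextP (n, Sq n) IH.
have SqC n i : (i < n)%N -> (Sq n).1 i = (Sq i.+1).1 i.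
  elim: n => // n IH; rewrite ltnS leq_eqVlt => /orP[/eqP -> //|ni].
  by have [_ /(_ i ni) -> _] := nextP (n, Sq n) (SqT n); exact: IH.
exists (fun n => (Sq n.+1).1 n), (fun n => (Sq n).2); split=> [n|n x]; last first.
  by have [_ _ /(_ x)] := nextP (n, Sq n) (SqT n).
have admE x v : admissible n (fun n => (Sq n.+1).1 n) x v -> admissible n (Sq n).1 x v.
  by move=> av i z /av[ni]; rewrite SqC.
have [cl lf fc fd fp fdep] := SqT n; split=> /=.
- by move=> i z ni; rewrite -(SqC n) //; exact: cl.
- by move=> i ni; rewrite -(SqC n) //; exact: lf.
- by move=> x v /admE; exact: fc.
- by move=> x v t i /admE; exact: fd.
- by move=> x v t /admE; exact: fp.
- by move=> x v t t' /admE; exact: fdep.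
Qed.

(** A point [x] goes to the point of the join with vertices [c n x] and coordinates [p n x], then to
    [Y] by [f K]. Bump functions of maximum 1 put it on top of its simplex. *)
Lemma refinable_selection : c_refinable [set: X] ->
  exists m, has_continuous_selection (phi m).
Proof.
move=> rX; have [[x0]|X0] := pselect (inhabited X); last first.
  have /choice[g _] : forall x : X, exists y : Y, True by move=> x; case: X0; exists.
  by exists 0%N, g; split=> x; case: X0; exists.
have [C [f [tw covC]]] := tower_sequence x0.
have [n z|//|K [B [WB covB]]] := rX (fun n z => (C n z)°).
  exact: open_interior.
have /choice[c cP] : forall n, exists c : X -> X, (n < K)%N -> forall x, B n x ->
    (C n (c x))° x /\ \forall y \near x, c y = c x.
  move=> n; have [nK|Kn] := ltnP n K; last by exists id.
  by have [_ [c cP]] := WB n nK; exists c => _ x /cP.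
pose B' n := [set x | (n < K)%N /\ B n x].
have oB' n : open (B' n).
  apply: open_from_near => x [nK Bx].
  by apply: filterS (near_open (WB n nK).1 Bx) => y; split.
have covB' x : exists n, B' n x by have [n [nK Bx]] := covB x I; exists n.
have [ O [oO covO _ OB]] := paracompact_shrink pX oB' covB'.
have [p [cp p01 p1 pO _]] := paracompact_bumps pX oO covO.
have pB n x : p n x != 0 -> B' n x by move=> /pO /subset_closure /OB.
pose v (x : X) n := if pselect (B' n x) then Some (c n x) else None.
have vB n x : B' n x -> v x n = Some (c n x) by rewrite /v; case: pselect.
have vN n x : ~ B' n x -> v x n = None by rewrite /v; case: pselect.
have av x : admissible K C x (v x).
  move=> n z; rewrite /v; case: pselect => // -[nK Bx] [<-]; split=> //.
  by apply: interior_subset; have [] := cP n nK x Bx.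
pose q (x : X) : {ptws nat -> RR} := fun n => p n x.
have qc x : hcube (q x) by move=> n; exact: p01.
have qt x : on_top (v x) (q x).
  have [n pn] := p1 x; exists n; split=> //.
  by rewrite vB //; apply: pB; rewrite pn oner_neq0.
have qcont : continuous q by apply: continuous_ptws.
exists (stage K), (fun x => f K (v x) (q x)); split; last first.
  by move=> x; exact: (tower_phi (tw K) (av x) (qc x) (qt x)).
move=> x.
(* Near x only the vertices present at x have nonzero coordinates. *)
have nearv : \forall y \near x, forall n, (n < K)%N ->
    (B n x -> B n y /\ c n y = c n x) /\ (~ B n x -> p n y = 0).
  apply: (@near_finite_forall _ _ _ `I_K) => [|n nK]; first exact: finite_II.
  have [Bx|nBx] := pselect (B n x).
    have [_ nc] := cP n nK x Bx.
    by move: nc (near_open (WB n nK).1 Bx); apply: filterS2 => y cy By.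
  have : ~ closure (O n) x by move=> /OB[].
  move/notin_closureP; apply: filterS => y nOy; split=> // _.
  by apply/eqP/negPn/negP => /pO.
(* Levels absent at [x] are dropped from [v y] one at a time; each has coordinate 0 at [y], so [f K]
   keeps its value, and [v x] is reached in the end. *)
pose w (y : X) (m : nat) : nat -> option X :=
  fun n => if (n < m)%N && ~~ `[< B n x >] then None else v y n.
have wS y m : w y m.+1 = if `[< B m x >] then w y m else drop_vertex (w y m) m.
  apply/funext => n; rewrite /w /drop_vertex ltnS leq_eqVlt.
  case: (asboolP (B m x)) => Bm.
    by case: (eqVneq n m) => [->|//]; rewrite (asboolT Bm) /= ?andbF ?ltnn.
  by case: (eqVneq n m) => [->|//]; rewrite (asboolF Bm).
have wP y : (forall n, (n < K)%N ->
    (B n x -> B n y /\ c n y = c n x) /\ (~ B n x -> p n y = 0)) ->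
    forall m, (m <= K)%N -> [/\ admissible K C y (w y m), on_top (w y m) (q y) &
      f K (v y) (q y) = f K (w y m) (q y)].
  move=> ny; elim=> [|m IH] mK.
    have -> : w y 0%N = v y by apply/funext.
    by split.
  have [aw tw' ew] := IH (ltnW mK); rewrite wS; case: asboolP => Bm //.
  have pm : q y m = 0 by have [_] := ny m mK; exact.
  split; [exact: admissible_drop | exact: on_top_drop |].
  by rewrite ew; exact: (tower_drop (tw K) aw).
have wK y : (forall n, (n < K)%N ->
    (B n x -> B n y /\ c n y = c n x) /\ (~ B n x -> p n y = 0)) -> w y K = v x.
  move=> ny; apply/funext => n; rewrite /w; have [nK|Kn] := ltnP n K; last first.
    by rewrite !vN // => -[]; rewrite ltnNge Kn.
  have [nB npn] := ny n nK; case: asboolP => Bx /=; last by rewrite vN // => -[].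
  by have [By cy] := nB Bx; rewrite !vB // cy.
have nearE : \forall y \near x, on_top (v x) (q y) /\ f K (v y) (q y) = f K (v x) (q y).
  apply: filterS nearv => y ny; have [_ tw' ew] := wP y ny K (leqnn K).
  by rewrite wK // in tw' ew.
have /within_continuousP fcont := tower_cont (tw K) (av x).
move=> P nP; have := fcont (q x) (conj (qc x) (qt x)) P nP.
move=> /(qcont x); rewrite /= => nq.
move: nearE nq; apply: filterS2 => y [ty ey] Py /=; rewrite ey.
by apply: Py; split.
Qed.
End Selection.

(** * From selections to disjoint families *)

Lemma open_graph_strongly_lsc (X Y : topologicalType) (theta : X -> set Y) :
  open_graph theta -> strongly_lsc theta.
Proof.
move=> oG K cK; apply: open_from_near => x Kx.
have /compact_near_coveringP/(_ X (nbhs x) (fun x' y => theta x' y)) := cK.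
apply=> y Ky; have [[P Q] /= [nP nQ] PQ] := near_open (x := (x, y)) oG (Kx _ Ky).
by exists (Q, P) => // -[y' x'] [/= Qy Px]; exact: (PQ (x', y')).
Qed.

Lemma tychonoff_ptws (J : choiceType) : tychonoff_space {ptws J -> RR}.
Proof.
split.
  by apply: hausdorff_accessible; apply: hausdorff_product => _; exact: Rhausdorff.
move=> y B clB nBy; have := @point_uniform_separator RR _ y B clB nBy.
move=> /(@uniform_separatorP _ RR)[f [cf _ f0 f1]]; exists f; split=> //.
split; first by apply: f0; exists y.
by move=> b Bb; apply: f1; exists b.
Qed.

Lemma within_continuous_ptws (S : topologicalType) (J : choiceType) (A : set S)
    (f : S -> {ptws J -> RR}) :
  (forall p, {within A, continuous (fun x => f x p)}) -> {within A, continuous f}.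
Proof.
move=> cf; apply/subspace_continuousP => x Ax.
have FF : Filter (f @ within A (nbhs x)) by exact: fmap_filter.
apply: (@pointwise_cvgP (discrete_topology J) RR _ (f x) FF).2 => p.
exact: ((@subspace_continuousP _ _ _ _).1 (cf p) x Ax).
Qed.

Lemma functionally_open_gt0 (X : topologicalType) (h : X -> RR) :
  continuous h -> functionally_open [set x | 0 < h x].
Proof.
move=> ch; exists (fun x => Num.max 0 (h x)); split.
  move=> x; apply: (@continuous_max _ _ (fun=> 0) h x); last exact: ch.
  exact: cst_continuous.
rewrite eqEsubset; split=> x /=; case: (ltP 0 (h x)) => //.
  by move=> /lt0r_neq0.
by rewrite eqxx.
Qed.

Lemma continuous_clamp (X : topologicalType) (h : X -> RR) :
  continuous h -> continuous (fun x => Num.max 0 (Num.min 1 (h x))).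
Proof.
move=> ch x.
have cm : {for x, continuous (fun x => Num.min 1 (h x) : RR)}.
  apply: (@continuous_min _ _ (fun=> 1) h x); last exact: ch.
  exact: cst_continuous.
apply: (@continuous_max _ _ (fun=> 0) (fun x => Num.min 1 (h x)) x); last exact: cm.
exact: cst_continuous.
Qed.

Lemma functionally_openI (X : topologicalType) (A B : set X) :
  functionally_open A -> functionally_open B -> functionally_open (A `&` B).
Proof.
move=> [f [cf ->]] [g [cg ->]]; exists (fun x => f x * g x); split.
  by move=> x; exact: (cvgM (cf x) (cg x)).
rewrite eqEsubset; split=> x /=; first by move=> [fx gx]; rewrite mulf_neq0.
by rewrite mulf_eq0 negb_or => /andP[].
Qed.

Lemma functionally_open_finite (X : topologicalType) (J : choiceType)
    (D : set J) (A : J -> set X) : finite_set D ->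
  (forall j, functionally_open (A j)) ->
  functionally_open [set x | forall j, D j -> A j x].
Proof.
move=> /finite_fsetP[E ->] /choice[f fP].
exists (fun x => \prod_(j <- E) f j x); split.
  by apply: (continuous_big mul_continuous) => j _; have [] := fP j.
rewrite eqEsubset; split=> x /= Ax.
  rewrite prodf_seq_neq0; apply/allP => j jE; have [_ Aj] := fP j.
  by have := Ax j jE; rewrite Aj.
move=> j jE; have [_ ->] := fP j.
by move: Ax; rewrite prodf_seq_neq0 => /allP /(_ j jE).
Qed.

(** * Set-valued maps whose selections encode disjoint refinements *)

Section ReadOff.
Variables (X : topologicalType) (omega : nat -> set (set X)).
Hypothesis fin_omega : forall n, finite_set (omega n).
Hypothesis fo_omega : forall n U, omega n U -> functionally_open U.
Hypothesis cov_omega : forall n, \bigcup_(U in omega n) U = setT.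

Let open_omega n U : omega n U -> open U.
Proof.
move=> /fo_omega[g [cg ->]]; apply: (open_comp (D := [set t : RR | t != 0])).
  by move=> x _; exact: cg.
exact: open_neq.
Qed.

Let J := (nat * set X)%type.
Let Y : topologicalType := {ptws J -> RR}.

(* A nonnegative coordinate (i, U) means that y selects U at level i. *)
Definition reads_well (i : nat) (x : X) (y : Y) : Prop :=
  (forall U, omega i U -> y (i, U) < 0 \/ U x) /\
  forall U U', omega i U -> omega i U' -> U <> U' -> y (i, U) < 0 \/ y (i, U') < 0.

Definition stops_at (j : nat) (x : X) (y : Y) : Prop :=
  (exists2 U, omega j U & 0 < y (j, U)) /\
  forall i, (i <= j)%N -> reads_well i x y.

(* The levels of y are read in increasing order until one stops; the levels
   after that are unconstrained, which makes the graph open. *)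
Definition stop_map (m : nat) (x : X) : set Y :=
  [set y | exists2 j, (j <= m)%N & stops_at j x y].

Let coord_cont (p : J) : continuous (fun z : X * Y => z.2 p).
Proof.
move=> z; apply: (@continuous_comp _ _ _ snd (fun y : Y => y p)).
  exact: cvg_snd.
exact: (@proj_continuous J (fun=> RR) p).
Qed.

(** Stopping at [j] involves finitely many members of the covers, each through open conditions on
    [x] and on single coordinates of [y]. *)
Lemma stop_map_open_graph m : open_graph (stop_map m).
Proof.
apply: open_from_near => -[x y] [j jm [[U oU yU] gj]].
have near_neg (p : J) : y p < 0 -> \forall z \near (x, y), z.2 p < 0.
  by move=> yp; exact: (@near_lt_continuous _ (fun z : X * Y => z.2 p) (fun=> 0) (x, y)
      (@coord_cont p) (@cst_continuous _ _ 0) yp).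
have near_pos : \forall z \near (x, y), 0 < z.2 (j, U).
  exact: (@near_lt_continuous _ (fun=> 0) (fun z : X * Y => z.2 (j, U)) (x, y)
      (@cst_continuous _ _ 0) (@coord_cont (j, U)) yU).
have near_g : \forall z \near (x, y), forall i, (i <= j)%N -> reads_well i z.1 z.2.
  apply: (@near_finite_forall _ _ _ `I_j.+1) => [|i ij]; first exact: finite_II.
  have [g1 g2] := gj i ij.
  have n1 : \forall z \near (x, y), forall V, omega i V -> z.2 (i, V) < 0 \/ V z.1.
    apply: near_finite_forall => // V oV; have [yV|Vx] := g1 V oV.
      by apply: filterS (near_neg _ yV) => z; left.
    have : \forall z \near (x, y), V z.1.
      by apply: (@cvg_fst _ _ (nbhs x) (nbhs y)); exact: near_open (open_omega oV) Vx.
    by apply: filterS => z; right.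
  have n2 : \forall z \near (x, y), forall V, omega i V -> forall V', omega i V' ->
      V <> V' -> z.2 (i, V) < 0 \/ z.2 (i, V') < 0.
    apply: near_finite_forall => // V oV; apply: near_finite_forall => // V' oV'.
    have [->|VV'] := pselect (V = V'); first by apply: (@filterE _ (nbhs (x, y))) => z; case.
    by have [yV|yV] := g2 V V' oV oV' VV'; apply: filterS (near_neg _ yV) => z ? _;
       [left | right].
  move: n1 n2; apply: filterS2 => z z1 z2; split=> // V V' oV oV'; exact: z2.
move: near_pos near_g; apply: filterS2 => z zU zg.
by exists j => //; split=> //; exists U.
Qed.

Lemma cover_member n x : exists2 U, omega n U & U x.
Proof.
have : [set: X] x by [].
by rewrite -(cov_omega n) => -[U oU Ux]; exists U.
Qed.

Let vertex (m : nat) (U : set X) : Y := fun p => if `[< p = (m, U) >] then 1 else -1.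

Let vertexE m U : vertex m U (m, U) = 1.
Proof. by rewrite /vertex asboolT. Qed.

Let vertexN m U i V : (i, V) <> (m, U) -> vertex m U (i, V) = -1.
Proof. by move=> iV; rewrite /vertex asboolF. Qed.

Let reads_well_vertex m U x i (y : Y) : omega m U -> U x ->
  (forall V, y (i, V) = vertex m U (i, V)) -> reads_well i x y.
Proof.
move=> oU Ux yE; have neg V : (i, V) <> (m, U) -> y (i, V) < 0.
  by move=> iV; rewrite yE vertexN //; lra.
split=> [V oV|V V' oV oV' VV'].
  have [[_ ->]|iV] := pselect ((i, V) = (m, U)); first by right.
  by left; exact: neg.
have [[im VU]|iV] := pselect ((i, V) = (m, U)); last by left; exact: neg.
by right; apply: neg => -[_ V'U]; apply: VV'; rewrite VU V'U.
Qed.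

Lemma stop_map_nonempty m : nonempty_valued (stop_map m).
Proof.
move=> x; have [U oU Ux] := cover_member 0 x; exists (vertex 0 U).
exists 0%N => //; split; first by exists U => //; rewrite vertexE.
by move=> i _; apply: (reads_well_vertex oU Ux).
Qed.

(* The contraction of a sphere in stop_map m x to a vertex of level m + 1 moves
   the levels one after the other, downwards from m + 1 to 0, so that a level
   is only cleared when all later ones already read well. *)
Let tau (m i : nat) (s : RR) : RR :=
  Num.max 0 (Num.min 1 (m.+2%:R * s - (m.+1 - i)%N%:R)).

Let tau_itv m i s : 0 <= tau m i s <= 1.
Proof. by rewrite /tau le_max lexx /= ge_max ler01 ge_min lexx. Qed.

Let tau_cont m i : continuous (tau m i).
Proof.
apply: continuous_clamp => s.
exact: (cvgB (cvgM (cvg_cst _) (@cvg_id _ (nbhs s))) (cvg_cst _)).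
Qed.

Let tau0 m i : tau m i 0 = 0.
Proof.
rewrite /tau mulr0 sub0r; apply/max_idPl; rewrite ge_min oppr_le0 ler0n.
by rewrite orbT.
Qed.

Let tau1 m i : tau m i 1 = 1.
Proof.
have le1 : 1 <= m.+2%:R * 1 - (m.+1 - i)%N%:R :> RR.
  by rewrite mulr1 lerBrDr addrC natr1 ler_nat; lia.
by rewrite /tau (min_idPl le1); apply/max_idPr.
Qed.

(** Level [i] moves between the times [(m+1-i)/(m+2)] and [(m+2-i)/(m+2)], so it has finished once a
    lower level starts. *)
Let tau_later m i j s : (j < i <= m.+1)%N -> 0 < tau m j s -> tau m i s = 1.
Proof.
move=> /andP[ji im] tj.
have j0 : 0 < m.+2%:R * s - (m.+1 - j)%N%:R.
  by move: tj; rewrite /tau lt_max ltxx /= lt_min => /andP[].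
have ij : (m.+1 - i)%N%:R + 1 <= (m.+1 - j)%N%:R :> RR.
  by rewrite natr1 ler_nat; lia.
have le1 : 1 <= m.+2%:R * s - (m.+1 - i)%N%:R by lra.
by rewrite /tau (min_idPl le1); apply/max_idPr.
Qed.

(** Negative coordinates of levels up to [m] move towards -1, so the levels up to [j] keep reading
    well. Either the positive coordinate at [j] survives, or level [j] has started to move; then all
    later levels agree with the vertex and the reading stops at [m + 1]. *)
Lemma stop_map_contraction m x U (y : Y) s : omega m.+1 U -> U x ->
  stop_map m x y ->
  stop_map m.+1 x (fun p => (1 - tau m p.1 s) * y p + tau m p.1 s * vertex m.+1 U p).
Proof.
move=> oU Ux [j jm [[V oV yV] gy]]; set z : Y := fun p => _.
have neg i W : (i <= m)%N -> y (i, W) < 0 -> z (i, W) < 0.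
  move=> im yW; rewrite /z /= vertexN; last by move=> [im']; lia.
  by have /andP[? ?] := tau_itv m i s; nra.
have gz i : (i <= j)%N -> reads_well i x z.
  move=> ij; have im := leq_trans ij jm; have [g1 g2] := gy i ij; split=> [W oW|W W' oW oW' WW'].
    by have [/(neg _ _ im)|Wx] := g1 W oW; [left | right].
  by have [/(neg _ _ im)|/(neg _ _ im)] := g2 W W' oW oW' WW'; [left | right].
have [zV|zV] := ltP 0 (z (j, V)).
  by exists j; [exact: leqW | split=> //; exists V].
have tj : 0 < tau m j s.
  rewrite lt_def; have /andP[-> _] := tau_itv m j s; rewrite andbT.
  by apply/eqP => t0; move: zV; rewrite /z /= t0 subr0 mul1r mul0r addr0 leNgt yV.
have zE i W : (j < i <= m.+1)%N -> z (i, W) = vertex m.+1 U (i, W).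
  by move=> ji; rewrite /z /= (tau_later ji tj) subrr mul0r add0r mul1r.
exists m.+1 => //; split; first by exists U => //; rewrite zE ?vertexE ?ltnS ?jm ?leqnn.
move=> i im; have [/gz//|ji] := leqP i j.
by apply: (reads_well_vertex oU Ux) => W; apply: zE; rewrite ji.
Qed.

Lemma stop_map_aspherical : aspherical stop_map.
Proof.
move=> x m; split; first by move=> y [j jm sy]; exists j => //; exact: leqW.
move=> k _ f cf fA; have [U oU Ux] := cover_member m.+1 x.
exists (fun w p => (1 - tau m p.1 w.2) * f w.1 p + tau m p.1 w.2 * vertex m.+1 U p).
split; last split; last split.
- apply: within_continuous_ptws => p.
  pose Q : set ('rV[RR]_k.+1 * RR) := sphere k `*` `[0, 1]%classic.
  have c1 : {within Q, continuous (fun w => f w.1 p)}.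
    have cfst : {within Q, continuous (fun w => f w.1)}.
      apply: (within_continuous_compose (f := fst)) cf; first by move=> w [].
      by apply: continuous_within => w _; exact: cvg_fst.
    apply: (@within_continuous_compose _ _ _ _ setT _ (fun y : Y => y p) _ cfst) => //.
    by apply: continuous_within => y _; exact: (@proj_continuous J (fun=> RR) p).
  have c2 : {within Q, continuous (fun w => tau m p.1 w.2)}.
    apply: continuous_within => w _.
    by apply: (@continuous_comp _ _ _ snd (tau m p.1)); [exact: cvg_snd | exact: tau_cont].
  apply/subspace_continuousP => w Sw.
  have d1 := (@subspace_continuousP _ _ _ _).1 c1 w Sw.
  have d2 := (@subspace_continuousP _ _ _ _).1 c2 w Sw.
  exact: (cvgD (cvgM (cvgB (cvg_cst _) d2) d1) (cvgM d2 (cvg_cst _))).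
- move=> t s St _; apply: stop_map_contraction => //; apply: fA; exists t => //.
- by move=> t St; apply/funext => p; rewrite tau0 subr0 mul1r mul0r addr0.
- by exists (vertex m.+1 U) => t St; apply/funext => p; rewrite tau1 subrr mul0r add0r mul1r.
Qed.

(** The member of [gamma j] from [U] consists of the points of [U] where the selection is positive
    at [(j, U)] and negative at the rest of level [j], whence disjointness. The level at which the
    reading stops yields a member containing the point. *)
Lemma stop_map_selection m : has_continuous_selection (stop_map m) ->
  exists (k : nat) (gamma : nat -> set (set X)),
      (forall n, (n < k)%N ->
         finite_set (gamma n) /\
         (forall U, gamma n U -> functionally_open U) /\
         (forall U V, gamma n U -> gamma n V -> U <> V -> U `&` V = set0) /\
         (forall U, gamma n U -> exists V, omega n V /\ U `<=` V)) /\
      \bigcup_(n in [set n | (n < k)%N]) \bigcup_(U in gamma n) U = setT.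
Proof.
move=> [g [cg gP]].
have cgp (p : J) : continuous (fun x => g x p).
  move=> x; apply: (@continuous_comp _ _ _ g (fun y : Y => y p)); first exact: cg.
  exact: (@proj_continuous J (fun=> RR) p).
pose V j U := [set x | U x] `&` ([set x | 0 < g x (j, U)] `&`
  [set x | forall U', (omega j `\ U) U' -> 0 < - g x (j, U')]).
exists m.+1, (fun j => V j @` omega j); split=> [j _|].
  split; [exact: finite_image | split; [|split]].
  - move=> _ [U oU <-]; apply: functionally_openI; first exact: (fo_omega oU).
    apply: functionally_openI; first exact: functionally_open_gt0.
    apply: functionally_open_finite; first exact: finite_setD.
    by move=> U'; apply: functionally_open_gt0 => x; exact: (cvgN (cgp _ x)).
  - move=> _ _ [U oU <-] [U' oU' <-] UU'.
    rewrite -subset0 => x [[_ [gU _]] [_ [_ gU']]].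
    have /gU' : (omega j `\ U') U by split=> // UU; apply: UU'; rewrite UU.
    by rewrite oppr_gt0 => /(lt_trans gU); rewrite ltxx.
  - by move=> _ [U oU <-]; exists U; split=> // x [].
rewrite eqEsubset; split=> // x _; have [j jm [[U oU gU] gx]] := gP x.
exists j => //=; exists (V j U); first by exists U.
have [g1 g2] := gx j (leqnn j); split.
  by have [|//] := g1 U oU; lra.
split=> //= U' [oU' UU']; have [||] := g2 U U' oU oU'; last by lra.
- by move=> UU; apply: UU'.
- by lra.
Qed.
End ReadOff.

Theorem theorem1p1 (X : topologicalType) (tyX : tychonoff_space X) (pX : paracompact X) :
  (finite_C_space X <->
   (forall (Y : topologicalType) (phi : nat -> X -> set Y),
      tychonoff_space Y ->
      (forall n, nonempty_valued (phi n)) ->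
      (forall n, strongly_lsc (phi n)) ->
      aspherical phi ->
      exists m, has_continuous_selection (phi m))) /\
  (finite_C_space X <->
   (forall (Y : topologicalType) (phi : nat -> X -> set Y),
      tychonoff_space Y ->
      (forall n, nonempty_valued (phi n)) ->
      (forall n, open_graph (phi n)) ->
      aspherical phi ->
      exists m, has_continuous_selection (phi m))).
Proof.
have ab : finite_C_space X -> forall (Y : topologicalType) (phi : nat -> X -> set Y),
    (forall n, nonempty_valued (phi n)) -> (forall n, strongly_lsc (phi n)) ->
    aspherical phi -> exists m, has_continuous_selection (phi m).
  move=> /(finite_C_refinable pX) rX Y phi phi_ne phi_lsc phi_asph.
  exact: refinable_selection.
have ca : (forall (Y : topologicalType) (phi : nat -> X -> set Y),
    tychonoff_space Y -> (forall n, nonempty_valued (phi n)) ->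
    (forall n, open_graph (phi n)) -> aspherical phi ->
    exists m, has_continuous_selection (phi m)) -> finite_C_space X.
  move=> sel omega omegaP.
  have fin_omega n : finite_set (omega n) by have [] := omegaP n.
  have fo_omega n U : omega n U -> functionally_open U by have [_ [+ _]] := omegaP n; apply.
  have cov_omega n : \bigcup_(U in omega n) U = setT by have [_ []] := omegaP n.
  have [||||m] := sel _ (stop_map omega).
  - exact: tychonoff_ptws.
  - exact: stop_map_nonempty.
  - exact: stop_map_open_graph.
  - exact: stop_map_aspherical.
  - exact: stop_map_selection.
split; split.
- by move=> fC Y phi _; exact: ab.
- move=> sel; apply: ca => Y phi tyY ne og asph; apply: sel => // n.
  exact: open_graph_strongly_lsc.
- move=> fC Y phi _ ne og asph; apply: ab => // n; exact: open_graph_strongly_lsc.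
- exact: ca.
Qed.
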